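(* Let $H\leq F$ be closed and act minimally on $(0,1)$, and suppose that $A=\pi_{\mathrm{ab}}(H)\le\mathbb Z^2$ has rank two. Let $\mathcal L=C(H)$, let $d_L$ and $d_R$ be the positive generators of the first and second coordinate projections of $A$, and set $q=[d_L\mathbb Z\times d_R\mathbb Z:A]$. Then, for every pair of inner vertices $u,v$ of $\mathcal L$, $$|\mathcal P(\mathcal L)(u,v)|=q.$$
   Context: Thompson's group $F$ is the group of increasing piecewise-linear homeomorphisms of $[0,1]$ with finitely many breakpoints, all dyadic rationals, and all slopes integral powers of $2$. The map $\pi_{\mathrm{ab}}\colon F\to\mathbb Z^2$ is $\pi_{\mathrm{ab}}(f)=(\log_2 f'(0^+),\log_2 f'(1^-))$. An action on $(0,1)$ is minimal if every orbit is dense in $(0,1)$. For $H\le F$, an element $f\in F$ is piecewise-$H$ if there are $0=c_0<\dots<c_n=1$ and $h_1,\dots,h_n\in H$ such that $f$ agrees with $h_i$ on $[c_{i-1},c_i]$ for each $i$. $H$ is closed if every piecewise-$H$ element of $F$ belongs to $H$. A directed 2-complex $L$ consists of a directed graph (each edge $e$ has an initial vertex $\iota(e)$ and a terminal vertex $\tau(e)$) and a set of positive 2-cells; each cell $f$ is equipped with two nonempty directed paths $\operatorname{top}(f),\operatorname{bot}(f)$ having the same initial vertex and the same terminal vertex. Two directed paths are homotopic if one is obtained from the other by finitely many replacements of a subpath $\operatorname{top}(f)$ by $\operatorname{bot}(f)$ or vice versa. $\mathcal P(L)(v,w)$ is the set of homotopy classes of nonempty directed paths from $v$ to $w$. The Stallings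 2-core $C(H)$ of $H\le F$. Every $g\in F$ has a unique reduced (minimal) tree pair $(T_+,T_-)$: finite rooted binary trees with the same number of leaves such that $g$ maps the $i$-th leaf interval of $T_+$ linearly onto the $i$-th leaf interval of $T_-$ (the root corresponds to $[0,1]$, the two children of a vertex to the left and right halves of its interval). Let $\Delta_g$ be the directed 2-complex with one edge for every vertex of $T_+$ and of $T_-$, where the $i$-th leaf edge of $T_+$ is identified with the $i$-th leaf edge of $T_-$, and one positive cell for each caret, whose top path is the parent edge and whose bottom path is the left child edge followed by the right child edge; vertices of $\Delta_g$ are the endpoints of edges, identified only as forced by these incidences. Choose a generating set $X$ of $H$, take all $\Delta_g$ ($g\in X$), and identify all root edges (of both trees, for all $g$) to a single edge $p_H$ (if $X=\varnothing$ take a single edge $p_H$). Then fold repeatedly: whenever two distinct cells have the same top path or the same bottom path, identify the cells and identify their other boundary paths edge by edge (if infinitely many foldings are needed, take the direct limit of a sequence in which no possible folding is postponed indefinitely). The result, with distinguished edge $p_H$, is $C(H)$; up to isomorphism preserving $p_H$ it is independent of $X$ and of the order of foldings. The vertices $\iota(p_H)$ and $\tau(p_H)$ are the initial and terminal vertices of $C(H)$; all other vertices are inner. *)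

(* Defs.v *)
From HB Require Import structures.
From Stdlib Require Import Relations.
From mathcomp Require Import all_boot all_order all_algebra.
From mathcomp Require Import generic_quotient.
From mathcomp Require Import finmap.
From mathcomp Require Import all_classical all_reals all_analysis.

Set Implicit Arguments.
Unset Strict Implicit.
Unset Printing Implicit Defensive.

Import Order.TTheory GRing.Theory Num.Theory.
Import numFieldNormedType.Exports.

Local Open Scope classical_set_scope.
Local Open Scope ring_scope.
Local Open Scope quotient_scope.

Section ThompsonF.
Variable R : realType.
Implicit Types (f g : R -> R) (H K X : set (R -> R)).

Definition dyadic (x : R) : Prop :=
  exists (m : int) (n : nat), x = m%:~R / 2%:R ^+ n.

(* [s] lists [c_1 < ... < c_n], the point [c_0 = 0] being left implicit. *)
Definition subdivision (s : seq R) : Prop := path <%R 0 s /\ last 0 s = 1.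

Definition on_pieces (s : seq R) (P : R -> R -> Prop) : Prop :=
  forall i, (i < size s)%N -> P (nth 0 (0 :: s) i) (nth 0 s i).

(* A homeomorphism of [0,1] is represented by its extension to the whole line
   by the identity, so that equality and composition in F are equality and
   composition of functions [R -> R]. *)
Record thompsonF f : Prop := ThompsonF {
  thompsonF_out : forall x, x \notin `[0, 1] -> f x = x;
  thompsonF_bij : set_bij `[0, 1] `[0, 1] f;
  thompsonF_cont : {within `[0, 1], continuous f};
  thompsonF_incr : {in `[0, 1] &, {homo f : x y / x < y}};
  thompsonF_pl : exists s : seq R,
    [/\ subdivision s, (forall c, c \in s -> dyadic c) &
        on_pieces s (fun a b => exists (k : int) (t : R),
          forall x, x \in `[a, b] -> f x = 2%:R ^ k * x + t)]
}.

Record subgroupF H : Prop := SubgroupF {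
  subgroupF_sub : H `<=` thompsonF;
  subgroupF_id : H id;
  subgroupF_comp : forall f g, H f -> H g -> H (f \o g);
  subgroupF_inv : forall f, H f -> exists g, [/\ H g, cancel f g & cancel g f]
}.

Definition generates X H : Prop :=
  X `<=` H /\ forall K, subgroupF K -> X `<=` K -> H `<=` K.

Definition piecewise H f : Prop :=
  exists2 s : seq R, subdivision s &
    on_pieces s (fun a b => exists2 h, H h &
      forall x, x \in `[a, b] -> f x = h x).

Definition closedF H : Prop :=
  forall f, thompsonF f -> piecewise H f -> H f.

Definition minimal_action H : Prop :=
  forall x, x \in `]0, 1[ -> `]0, 1[ `<=` closure [set h x | h in H].

(* [pi_ab f a] reads [pi_ab(f) = a]: the one-sided derivatives of [f] at the
   endpoints are the powers of 2 with exponents [a.1] and [a.2]. *)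
Definition pi_ab f (a : int * int) : Prop :=
  ((f x - f 0) / (x - 0) @[x --> 0^'+] --> (2%:R ^ a.1 : R)) /\
  ((f x - f 1) / (x - 1) @[x --> 1^'-] --> (2%:R ^ a.2 : R)).

Definition pi_ab_image H : set (int * int) :=
  [set a | exists2 h, H h & pi_ab h a].

End ThompsonF.

Definition Zfree (r : nat) (a : 'I_r -> int * int) : Prop :=
  forall c : 'I_r -> int, \sum_i a i *~ c i = 0 -> forall i, c i = 0.

Definition has_rank (A : set (int * int)) (r : nat) : Prop :=
  (exists2 a : 'I_r -> int * int, forall i, A (a i) & Zfree a) /\
  ~ (exists2 a : 'I_r.+1 -> int * int, forall i, A (a i) & Zfree a).

Definition multiples (d : int) : set int := [set d * k | k in setT].

Definition cosets (B A : set (int * int)) : set (set (int * int)) :=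
  [set [set b + a | a in A] | b in B].

(* As everywhere with [fset_set], an infinite index would be read as 0. *)
Definition subgroup_index (B A : set (int * int)) : nat :=
  #|` fset_set (cosets B A)|%fset.

Record digraph := Digraph {
  vertex : Type;
  edge : Type;
  ini : edge -> vertex;
  ter : edge -> vertex
}.

Fixpoint dpath (G : digraph) (v : vertex G) (p : seq (edge G))
    (w : vertex G) : Prop :=
  if p is e :: p' then ini e = v /\ dpath (ter e) p' w else v = w.

Record complex2 := Complex2 {
  skeleton :> digraph;
  cell : Type;
  top : cell -> seq (edge skeleton);
  bot : cell -> seq (edge skeleton);
  cellP : forall c, [/\ top c <> [::], bot c <> [::] &
    exists v w, dpath v (top c) w /\ dpath v (bot c) w]
}.

Inductive elementary_homotopy (K : complex2) :
    seq (edge K) -> seq (edge K) -> Prop :=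
| ElementaryHomotopy p (c : cell K) q :
    elementary_homotopy (p ++ top c ++ q) (p ++ bot c ++ q).

Definition homotopic (K : complex2) : relation (seq (edge K)) :=
  clos_refl_sym_trans _ (@elementary_homotopy K).

Definition path_classes (K : complex2) (v w : vertex K) :
    set (set (seq (edge K))) :=
  [set [set p' | homotopic p p'] |
    p in [set p : seq (edge K) | p <> [::] /\ dpath v p w]].

Inductive tree := Leaf | Node of tree & tree.

(* A vertex of a tree is the sequence of turns leading to it from the root,
   [false] for left and [true] for right. *)
Fixpoint leaves (t : tree) : seq (seq bool) :=
  if t is Node l r
  then map (cons false) (leaves l) ++ map (cons true) (leaves r)
  else [:: [::]].

Fixpoint carets (t : tree) : seq (seq bool) :=
  if t is Node l r
  then [::] :: map (cons false) (carets l) ++ map (cons true) (carets r)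
  else [::].

Definition nodes (t : tree) : seq (seq bool) := carets t ++ leaves t.

Section TreePairs.
Variable R : realType.

Fixpoint lower (a : seq bool) : R :=
  if a is b :: a' then (b%:R + lower a') / 2%:R else 0.

Definition width (a : seq bool) : R := 2%:R ^- size a.

Definition tree_interval (a : seq bool) : set R :=
  `[lower a, lower a + width a].

Definition represents (P : tree * tree) (g : R -> R) : Prop :=
  size (leaves P.1) = size (leaves P.2) /\
  forall i, (i < size (leaves P.1))%N ->
    let a := nth [::] (leaves P.1) i in
    let b := nth [::] (leaves P.2) i in
    forall x, tree_interval a x ->
      g x = lower b + (width b / width a) * (x - lower a).

Definition sibling_leaves (t : tree) (i : nat) : Prop :=
  [/\ (i.+1 < size (leaves t))%N &
      exists a, nth [::] (leaves t) i = rcons a false /\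
                nth [::] (leaves t) i.+1 = rcons a true].

Definition reduced (P : tree * tree) : Prop :=
  forall i, ~ (sibling_leaves P.1 i /\ sibling_leaves P.2 i).

End TreePairs.

Lemma carets_nodes t a : a \in carets t -> a \in nodes t.
Proof. by rewrite mem_cat => ->. Qed.

Lemma nil_nodes t : [::] \in nodes t.
Proof. by case: t. Qed.

Lemma mem_map_cons (b c : bool) a (s : seq (seq bool)) :
  (b :: a \in map (cons c) s) = (b == c) && (a \in s).
Proof.
apply/mapP/andP => [[x xs [-> ->]]|[/eqP -> xs]]; last by exists a.
by rewrite eqxx.
Qed.

Lemma mem_nodes_cons b a l r :
  (b :: a \in nodes (Node l r)) = (a \in nodes (if b then r else l)).
Proof.
rewrite /nodes /= mem_cat in_cons !mem_cat !mem_map_cons /=.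
by case: b; rewrite /= ?orbF ?orFb.
Qed.

Lemma child_nodes t a b : a \in carets t -> rcons a b \in nodes t.
Proof.
elim: t a => [//|l IHl r IHr] [|c a] /=.
  by move=> _; rewrite mem_nodes_cons nil_nodes.
rewrite in_cons /= mem_cat !mem_map_cons mem_nodes_cons.
by case: c => /=; rewrite ?orbF ?orFb; [exact: IHr|exact: IHl].
Qed.

Section Core.
Variables (R : realType) (X : set (R -> R)).

Record diagram := Diagram {
  diag_elt : R -> R;
  diag_pair : tree * tree;
  diag_gen : X diag_elt;
  diag_rep : represents diag_pair diag_elt;
  diag_red : reduced diag_pair
}.

(* [true] selects [T_+], [false] selects [T_-]. *)
Definition side (D : diagram) (s : bool) : tree :=
  if s then (diag_pair D).1 else (diag_pair D).2.

Record tree_vertex := TreeVertex {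
  tv_diag : diagram;
  tv_side : bool;
  tv_addr : seq bool;
  tv_mem : tv_addr \in nodes (side tv_diag tv_side)
}.

(* [None] is a separate edge, to which all root edges get glued: it is the
   distinguished edge, also when there is no diagram at all. *)
Definition pre_edge := option tree_vertex.

Record pre_cell := PreCell {
  pc_diag : diagram;
  pc_side : bool;
  pc_addr : seq bool;
  pc_mem : pc_addr \in carets (side pc_diag pc_side)
}.

Definition parent (c : pre_cell) : pre_edge :=
  Some (TreeVertex (carets_nodes (pc_mem c))).
Definition left_child (c : pre_cell) : pre_edge :=
  Some (TreeVertex (child_nodes false (pc_mem c))).
Definition right_child (c : pre_cell) : pre_edge :=
  Some (TreeVertex (child_nodes true (pc_mem c))).

(* Identifications between edges and between cells: gluing of the leaf edges
   and of the root edges, then folding.  A folding sequence produces an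
   increasing sequence of pairs of equivalence relations, and its direct limit
   is the quotient by their union.  If no possible folding is postponed
   indefinitely, this union is the least pair of equivalence relations closed
   under the rules below. *)
Inductive same_edge : pre_edge -> pre_edge -> Prop :=
| same_edge_refl e : same_edge e e
| same_edge_sym e e' : same_edge e e' -> same_edge e' e
| same_edge_trans e e' e'' :
    same_edge e e' -> same_edge e' e'' -> same_edge e e''
| glue_roots e : tv_addr e = [::] -> same_edge None (Some e)
| glue_leaves e e' i :
    tv_diag e = tv_diag e' -> tv_side e = true -> tv_side e' = false ->
    (i < size (leaves (side (tv_diag e) true)))%N ->
    tv_addr e = nth [::] (leaves (side (tv_diag e) true)) i ->
    tv_addr e' = nth [::] (leaves (side (tv_diag e) false)) i ->
    same_edge (Some e) (Some e')
| same_cell_parent c c' : same_cell c c' -> same_edge (parent c) (parent c')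
| same_cell_left c c' :
    same_cell c c' -> same_edge (left_child c) (left_child c')
| same_cell_right c c' :
    same_cell c c' -> same_edge (right_child c) (right_child c')
with same_cell : pre_cell -> pre_cell -> Prop :=
| same_cell_refl c : same_cell c c
| same_cell_sym c c' : same_cell c c' -> same_cell c' c
| same_cell_trans c c' c'' :
    same_cell c c' -> same_cell c' c'' -> same_cell c c''
| fold_top c c' : same_edge (parent c) (parent c') -> same_cell c c'
| fold_bot c c' :
    same_edge (left_child c) (left_child c') ->
    same_edge (right_child c) (right_child c') -> same_cell c c'.

(* [(e, false)] is the initial endpoint of [e], [(e, true)] the terminal one. *)
Definition endpoint := (pre_edge * bool)%type.

Inductive same_vertex : endpoint -> endpoint -> Prop :=
| same_vertex_refl x : same_vertex x x
| same_vertex_sym x y : same_vertex x y -> same_vertex y x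
| same_vertex_trans x y z :
    same_vertex x y -> same_vertex y z -> same_vertex x z
| same_edge_vertex e e' b : same_edge e e' -> same_vertex (e, b) (e', b)
| caret_ini c : same_vertex (parent c, false) (left_child c, false)
| caret_mid c : same_vertex (left_child c, true) (right_child c, false)
| caret_ter c : same_vertex (right_child c, true) (parent c, true).

HB.instance Definition _ := gen_eqMixin tree_vertex.
HB.instance Definition _ := gen_choiceMixin tree_vertex.
HB.instance Definition _ := gen_eqMixin pre_cell.
HB.instance Definition _ := gen_choiceMixin pre_cell.

Definition same_edgeb (e e' : pre_edge) : bool := `[< same_edge e e' >].
Definition same_cellb (c c' : pre_cell) : bool := `[< same_cell c c' >].
Definition same_vertexb (x y : endpoint) : bool := `[< same_vertex x y >].

Lemma same_edgeb_refl : reflexive same_edgeb.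
Proof. by move=> e; apply/asboolP; exact: same_edge_refl. Qed.
Lemma same_edgeb_sym : symmetric same_edgeb.
Proof.
by move=> e e'; apply/asboolP/asboolP => h; exact: same_edge_sym.
Qed.
Lemma same_edgeb_trans : transitive same_edgeb.
Proof.
move=> e' e e'' /asboolP h /asboolP h'; apply/asboolP.
exact: same_edge_trans h h'.
Qed.
Canonical same_edge_equiv :=
  EquivRel same_edgeb same_edgeb_refl same_edgeb_sym same_edgeb_trans.

Lemma same_cellb_refl : reflexive same_cellb.
Proof. by move=> c; apply/asboolP; exact: same_cell_refl. Qed.
Lemma same_cellb_sym : symmetric same_cellb.
Proof.
by move=> c c'; apply/asboolP/asboolP => h; exact: same_cell_sym.
Qed.
Lemma same_cellb_trans : transitive same_cellb.
Proof.
move=> c' c c'' /asboolP h /asboolP h'; apply/asboolP.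
exact: same_cell_trans h h'.
Qed.
Canonical same_cell_equiv :=
  EquivRel same_cellb same_cellb_refl same_cellb_sym same_cellb_trans.

Lemma same_vertexb_refl : reflexive same_vertexb.
Proof. by move=> x; apply/asboolP; exact: same_vertex_refl. Qed.
Lemma same_vertexb_sym : symmetric same_vertexb.
Proof.
by move=> x y; apply/asboolP/asboolP => h; exact: same_vertex_sym.
Qed.
Lemma same_vertexb_trans : transitive same_vertexb.
Proof.
move=> y x z /asboolP h /asboolP h'; apply/asboolP.
exact: same_vertex_trans h h'.
Qed.
Canonical same_vertex_equiv :=
  EquivRel same_vertexb same_vertexb_refl same_vertexb_sym same_vertexb_trans.

Definition core_edge := {eq_quot same_edge_equiv}.
Definition core_cell := {eq_quot same_cell_equiv}.
Definition core_vertex := {eq_quot same_vertex_equiv}.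

Definition core_ini (e : core_edge) : core_vertex := \pi_core_vertex (repr e, false).
Definition core_ter (e : core_edge) : core_vertex := \pi_core_vertex (repr e, true).

Definition core_skeleton : digraph := Digraph core_ini core_ter.

Definition core_top (c : core_cell) : seq core_edge :=
  [:: \pi_core_edge (parent (repr c))].
Definition core_bot (c : core_cell) : seq core_edge :=
  [:: \pi_core_edge (left_child (repr c)); \pi_core_edge (right_child (repr c))].

Lemma core_endpoint (e : pre_edge) (b : bool) :
  \pi_core_vertex (repr (\pi_core_edge e), b) = \pi_core_vertex (e, b).
Proof.
apply/eqmodP/asboolP; apply: same_edge_vertex; apply/asboolP.
have h : \pi_core_edge (repr (\pi_core_edge e)) = \pi_core_edge e.
  exact: reprK.
by move/eqmodP: h.
Qed.

Lemma core_cellP (c : core_cell) :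
  [/\ core_top c <> [::], core_bot c <> [::] &
    exists v w : vertex core_skeleton,
      dpath v (core_top c : seq (edge core_skeleton)) w /\
      dpath v (core_bot c : seq (edge core_skeleton)) w].
Proof.
split => //.
exists (\pi_core_vertex (parent (repr c), false)).
exists (\pi_core_vertex (parent (repr c), true)).
rewrite /core_top /core_bot /= /core_ini /core_ter !core_endpoint.
do !split => //; apply/eqmodP/asboolP.
- exact/same_vertex_sym/caret_ini.
- exact/same_vertex_sym/caret_mid.
- exact: caret_ter.
Qed.

Definition core : complex2 := @Complex2 core_skeleton _ _ _ core_cellP.

Definition core_root : edge core := \pi_core_edge None.

Definition inner (v : vertex core) : Prop :=
  v <> ini core_root /\ v <> ter core_root.

End Core.

(* Main.v *)
Require Import Defs.
From Stdlib Require Import Relations.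
From mathcomp Require Import all_boot all_order all_algebra.
From mathcomp Require Import generic_quotient.
From mathcomp Require Import zify ring lra.
From mathcomp Require Import all_classical all_reals all_analysis.

Set Implicit Arguments.
Unset Strict Implicit.
Unset Printing Implicit Defensive.

Import Order.TTheory GRing.Theory Num.Theory.
Import numFieldNormedType.Exports.
Local Open Scope classical_set_scope.
Local Open Scope ring_scope.

(** Write an edge of the core as a binary word, i.e. a standard dyadic interval.
    Two words give the same edge iff some element of [H] maps one interval affinely onto the
    other: the generators are read off in the core, hence so are all elements of [H], and
    conversely foldings can be imitated by pasting because [H] is closed.  Minimality makes
    every word readable.  Hence vertices are [H]-orbits of dyadic points, and, pasting again,
    homotopy classes of paths from [u] to [v] are the [H]-orbits of pairs [x < y] with [x] in
    [u] and [y] in [v].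

    Fix [x0] in [u] and [y0] in [v], both in (0,1).  A class is represented by a pair
    [(x0, h y0)], and is sent to the coset of [(k,0)] modulo [A], where [2^k] is the slope of
    [h] at 0.  Pasting with the identity at [x0] and [y0] shows that this is well defined.
    For injectivity one needs: if [h y = y'] with [x0 < y, y'] and [(k,0)] is in [A], then
    some element fixing [x0] maps [y] to [y'].  Conjugating an element of [H] with slopes
    [(-k,0)] into [0,y] one may assume that [h] is trivial on some [0,a]; an element trivial
    to the right of [y] and [y'] and pushing [a] beyond [x0] conjugates [h] to what is wanted.
    Since [A] projects onto the multiples of [dL] and of [dR], every coset is reached. *)

(** * Dyadic intervals as binary words *)

Section Words.
Variable R : realType.
Implicit Types (a b c w : seq bool) (x y z t : R).
Local Notation lo := (lower R).
Local Notation wd := (width R).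

Definition upper a : R := lo a + wd a.

Lemma width_gt0 a : 0 < wd a.
Proof. by rewrite /width invr_gt0 exprn_gt0. Qed.

Lemma width_nil : wd [::] = 1.
Proof. by rewrite /width expr0 invr1. Qed.

Lemma width_cons (b : bool) a : wd (b :: a) = wd a / 2%:R.
Proof. by rewrite /width /= exprS invfM mulrC. Qed.

Lemma width_cat a w : wd (a ++ w) = wd a * wd w.
Proof. by rewrite /width size_cat exprD invfM. Qed.

Lemma upper_nil : upper [::] = 1.
Proof. by rewrite /upper width_nil add0r. Qed.

Lemma upper_cons (b : bool) a : upper (b :: a) = (b%:R + upper a) / 2%:R.
Proof. by rewrite /upper width_cons /= -mulrDl addrA. Qed.

Lemma lower_cat a w : lo (a ++ w) = lo a + wd a * lo w.
Proof.
elim: a => [|b a IH] /=; first by rewrite width_nil add0r mul1r.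
by rewrite IH width_cons; field.
Qed.

Lemma upper_cat a w : upper (a ++ w) = lo a + wd a * upper w.
Proof. by rewrite /upper width_cat lower_cat mulrDr addrA. Qed.

Lemma lower_lt_upper a : lo a < upper a.
Proof. by rewrite ltrDl width_gt0. Qed.

Lemma lower_ge0 a : 0 <= lo a.
Proof.
by elim: a => //= b a IH; rewrite divr_ge0 // addr_ge0.
Qed.

Lemma upper_le1 a : upper a <= 1.
Proof.
elim: a => [|b a IH]; first by rewrite upper_nil.
by rewrite upper_cons; case: b => /=; lra.
Qed.

Lemma upper_gt0 a : 0 < upper a.
Proof. exact: le_lt_trans (lower_ge0 a) (lower_lt_upper a). Qed.

Lemma lower_lt1 a : lo a < 1.
Proof. exact: lt_le_trans (lower_lt_upper a) (upper_le1 a). Qed.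

Lemma width_inj_size a b : wd a = wd b -> size a = size b.
Proof.
move=> /invr_inj; apply: contra_eq => ne; case: (ltngtP (size a) (size b)) ne => // h _.
  by rewrite lt_eqF // ltr_eXn2l // ltr1n.
by rewrite gt_eqF // ltr_eXn2l // ltr1n.
Qed.

(** Words with different first letters have intervals in opposite halves of [0,1], which meet at
    most in 1/2; so overlapping interiors force equal letters as long as both words last. *)
Lemma nested_prefix a b :
  lo a < upper b -> lo b < upper a -> prefix a b || prefix b a.
Proof.
elim: a b => [|c a IH] [|d b] //=.
rewrite !upper_cons => h1 h2.
have [La Ua] := (lower_ge0 a, upper_le1 a).
have [Lb Ub] := (lower_ge0 b, upper_le1 b).
case: c d h1 h2 => [] [] h1 h2 /=; last 1 first.
- by apply: IH; move: h1 h2 => /=; lra.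
- by apply: IH; move: h1 h2 => /=; lra.
- by exfalso; move: h1 h2 => /=; lra.
- by exfalso; move: h1 h2 => /=; lra.
Qed.

Lemma lower_width_inj a b : lo a = lo b -> size a = size b -> a = b.
Proof.
move=> hl hs; have hw : wd a = wd b by rewrite /width hs.
have : prefix a b || prefix b a.
  by apply: nested_prefix; rewrite /upper ?hl ?hw ltrDl width_gt0.
move=> /orP[] /prefixP[w e]; move: hs; rewrite e size_cat.
  by rewrite -[LHS]addn0 => /addnI/esym/size0nil ->; rewrite cats0.
by rewrite -[RHS]addn0 => /addnI/size0nil ->; rewrite cats0.
Qed.

(** Dyadic numbers of bounded level: fixing the exponent gives a definite gap between consecutive
    points, which [dyadic] does not. *)
Definition grid (n : nat) x := exists m : int, x = m%:~R / 2%:R ^+ n.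

Lemma grid_leq n m x : (n <= m)%N -> grid n x -> grid m x.
Proof.
move=> nm [k ->]; exists (k * 2 ^+ (m - n)).
rewrite -{2}(subnK nm) exprD rmorphM rmorphXn /=.
by field; rewrite !expf_neq0.
Qed.

Lemma dyadic_grid x : dyadic x <-> exists n, grid n x.
Proof. by split=> [[m [n h]]|[n [m h]]]; [exists n, m|exists m, n]. Qed.

Lemma gridD n x y : grid n x -> grid n y -> grid n (x + y).
Proof.
by move=> [k ->] [l ->]; exists (k + l); rewrite rmorphD mulrDl.
Qed.

Lemma gridN n x : grid n x -> grid n (- x).
Proof. by move=> [k ->]; exists (- k); rewrite rmorphN mulNr. Qed.

Lemma gridB n x y : grid n x -> grid n y -> grid n (x - y).
Proof. by move=> hx /gridN; apply: gridD. Qed.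

Lemma grid_int n (m : int) : grid n m%:~R.
Proof.
apply: (@grid_leq 0) => //; exists m; by rewrite expr0 divr1.
Qed.

Lemma grid0 n : grid n 0.
Proof. exact: (grid_int n 0). Qed.

Lemma grid1 n : grid n 1.
Proof. exact: (grid_int n 1). Qed.

Lemma grid_width n : grid n (2%:R ^- n).
Proof. by exists 1; rewrite mul1r. Qed.

Lemma gridX2 n x : grid n.+1 x <-> grid n (2%:R * x).
Proof.
split=> -[m h]; exists m; first by rewrite h exprS; field; rewrite expf_neq0.
rewrite exprS invfM mulrCA -h; field; by [].
Qed.

Lemma grid_lower a : grid (size a) (lo a).
Proof.
elim: a => [|b a IH] /=; first exact: grid0.
by apply/gridX2; rewrite [2%:R * _]mulrC divfK //; apply: gridD => //; exact: (grid_int _ b).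
Qed.

Lemma grid_upper a : grid (size a) (upper a).
Proof. by apply: gridD; [exact: grid_lower|exact: grid_width]. Qed.

Lemma dyadic_lower a : dyadic (lo a).
Proof. by apply/dyadic_grid; exists (size a); apply: grid_lower. Qed.

Lemma dyadic_upper a : dyadic (upper a).
Proof. by apply/dyadic_grid; exists (size a); apply: grid_upper. Qed.

Lemma grid_lt n x y : grid n x -> grid n y -> x < y -> x + 2%:R ^- n <= y.
Proof.
move=> [k ->] [l ->]; rewrite ltr_pM2r ?invr_gt0 ?exprn_gt0 // ltr_int => kl.
rewrite -[X in _ + X]mul1r -mulrDl ler_pM2r ?invr_gt0 ?exprn_gt0 //.
by rewrite -[1 in X in X <= _](mulr1z (1 : R)) -rmorphD ler_int; lia.
Qed.

(** A breakpoint of level [n] cannot cut the interval of a word of length at least [n]; hence long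
    words lie within one affine piece. *)
Lemma grid_side n x a : grid n x -> (n <= size a)%N -> (upper a <= x) || (x <= lo a).
Proof.
move=> hx hn; have [|h] := leP x (lo a); first by rewrite orbT.
by rewrite orbF; apply: grid_lt h; [exact: grid_lower|exact: grid_leq hx].
Qed.

Lemma word_at n x : grid n x -> 0 <= x -> x < 1 ->
  exists2 a, size a = n & lo a = x.
Proof.
elim: n x => [|n IH] x hx x0 x1.
  exists [::] => //=; case: hx x0 x1 => m ->; rewrite expr0 divr1.
  rewrite ler0z ltrz1 => m0 m1; have -> : m = 0 by lia.
  by [].
move/gridX2: hx => hx; have [h|h] := ltP x (2%:R^-1).
  have [|||a sa la] := IH (2%:R * x) => //; try lra.
  by exists (false :: a); rewrite /= ?sa // la; lra.
have [|||a sa la] := IH (2%:R * x - 1); try lra.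
  exact: gridB hx (grid1 n).
by exists (true :: a); rewrite /= ?sa // la; lra.
Qed.

Lemma word_ending n x : grid n x -> 0 < x -> x <= 1 ->
  exists2 a, size a = n & upper a = x.
Proof.
move=> hx x0 x1; have := grid_lt (grid0 n) hx x0; rewrite add0r => h.
have [||a sa la] := word_at (gridB hx (grid_width n)).
- by rewrite subr_ge0.
- by apply: lt_le_trans x1; rewrite ltrBlDr ltrDl invr_gt0 exprn_gt0.
by exists a => //; rewrite /upper la /width sa subrK.
Qed.

(** Adjacent intervals filling [x,y] from left to right; naming an edge of the core by each word
    will turn a chain into a directed path. *)
Fixpoint chain x (ws : seq (seq bool)) y : Prop :=
  if ws is a :: ws' then lo a = x /\ chain (upper a) ws' y else x = y.

Lemma chain_cat x ws ws' y z : chain x ws y -> chain y ws' z -> chain x (ws ++ ws') z.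
Proof. by elim: ws x => [x ->|a ws IH x] //= [-> h] h'; split => //; apply: IH. Qed.

Lemma chain_le x ws y : chain x ws y -> x <= y.
Proof.
elim: ws x => [x -> //|a ws IH x] /= [<- /IH]; apply: le_trans.
exact/ltW/lower_lt_upper.
Qed.

(** Left endpoint and length determine each word in turn, and a surplus word would overshoot [y].
    This compares paths after refinement to a common level. *)
Lemma chain_uniform n x ws ws' y :
  {in ws, forall a, size a = n} -> {in ws', forall a, size a = n} ->
  chain x ws y -> chain x ws' y -> ws = ws'.
Proof.
elim: ws x ws' => [|a ws IH] x [|a' ws'] hs hs' //=.
- by move=> -> [l /chain_le]; rewrite leNgt -l lower_lt_upper.
- by move=> [l /chain_le] h e; move: h; rewrite leNgt -e -l lower_lt_upper.
move=> [l h] [l' h']; have ea : a = a'.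
  apply: lower_width_inj; first by rewrite l l'.
  by rewrite hs ?mem_head // hs' ?mem_head.
rewrite -ea in h' *; congr cons; apply: IH h h' => b hb.
- by apply: hs; rewrite in_cons hb orbT.
- by apply: hs'; rewrite in_cons hb orbT.
Qed.

Lemma chain_exists n x y : grid n x -> grid n y -> 0 <= x -> y <= 1 -> x <= y ->
  exists ws, chain x ws y.
Proof.
move=> hx hy x0 y1 xy.
have [k hk] : exists k : nat, y - x = k%:R / 2%:R ^+ n.
  have [m hm] := gridB hy hx; exists `|m|%N.
  have : 0 <= m%:~R / 2%:R ^+ n :> R by rewrite -hm subr_ge0.
  rewrite pmulr_lge0 ?invr_gt0 ?exprn_gt0 // ler0z => m0.
  by rewrite hm natr_absz ger0_norm.
elim: k x hx x0 xy hk => [|k IH] x hx x0 xy hk.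
  by exists [::] => /=; apply/eqP; rewrite eq_sym -subr_eq0 hk mul0r.
have xy' : x < y.
  by rewrite -subr_gt0 hk mulr_gt0 // invr_gt0 exprn_gt0.
have [|a sa la] := word_at hx x0; first exact: lt_le_trans y1.
have ua : upper a = x + 2%:R ^- n by rewrite /upper la /width sa.
have [||||ws h] := IH (upper a).
- by rewrite ua; apply: gridD => //; apply: grid_width.
- exact/ltW/upper_gt0.
- by rewrite ua; apply: grid_lt.
- rewrite ua opprD addrA hk -natr1; ring.
by exists (a :: ws).
Qed.

Fixpoint subd (n : nat) a : seq (seq bool) :=
  if n is n'.+1 then subd n' (rcons a false) ++ subd n' (rcons a true) else [:: a].

Lemma lower_rcons a (b : bool) : lo (rcons a b) = lo a + b%:R * (wd a / 2%:R).
Proof. by rewrite -cats1 lower_cat /=; ring. Qed.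

Lemma upper_rcons a (b : bool) : upper (rcons a b) = lo a + (1 + b%:R) * (wd a / 2%:R).
Proof. by rewrite -cats1 upper_cat /= upper_cons upper_nil; ring. Qed.

Lemma size_subd n a b : b \in subd n a -> size b = (size a + n)%N.
Proof.
elim: n a => [|n IH] a /=; first by rewrite inE addn0 => /eqP ->.
by rewrite mem_cat => /orP[] /IH ->; rewrite size_rcons addSnnS.
Qed.

Lemma chain_subd n a : chain (lo a) (subd n a) (upper a).
Proof.
elim: n a => [|n IH] a //=.
have h := IH (rcons a true).
have e : lo (rcons a true) = upper (rcons a false).
  by rewrite lower_rcons upper_rcons /=; ring.
rewrite e in h; have := chain_cat (IH (rcons a false)) h.
have -> : lo (rcons a false) = lo a by rewrite lower_rcons /=; ring.
by have -> : upper (rcons a true) = upper a by rewrite upper_rcons /upper /=; field.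
Qed.

End Words.

(** * Affine maps between dyadic intervals, and pasting in F *)

Section Lin.
Variable R : realType.
Implicit Types (a b w : seq bool) (x y z t : R) (f g h : R -> R).
Local Notation lo := (lower R).
Local Notation wd := (width R).

(** The condition that [represents] imposes on one pair of leaves. *)
Definition lin f a b : Prop :=
  forall x, lo a <= x <= upper R a -> f x = lo b + (wd b / wd a) * (x - lo a).

Lemma width_neq0 a : wd a != 0.
Proof. by rewrite gt_eqF // width_gt0. Qed.

Lemma lin_lower f a b : lin f a b -> f (lo a) = lo b.
Proof.
move=> /(_ (lo a)) ->; first by rewrite subrr mulr0 addr0.
by rewrite lexx ltW // lower_lt_upper.
Qed.

Lemma lin_upper f a b : lin f a b -> f (upper R a) = upper R b.
Proof.
move=> /(_ (upper R a)) ->; last by rewrite lexx andbT ltW // lower_lt_upper.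
by rewrite /upper; field; rewrite width_neq0.
Qed.

Lemma lin_id a : lin id a a.
Proof. by move=> x _; rewrite divff ?width_neq0 // mul1r addrC subrK. Qed.

Lemma lin_range f a b x : lin f a b -> lo a <= x <= upper R a -> lo b <= f x <= upper R b.
Proof.
move=> h hx; rewrite (h _ hx); move/andP: hx => [h1 h2].
have r0 : 0 < wd b / wd a by rewrite divr_gt0 ?width_gt0.
rewrite lerDl mulr_ge0 ?(ltW r0) ?subr_ge0 //= lerD2l.
rewrite -[leRHS](divfK (width_neq0 a)) ler_wpM2l ?(ltW r0) //.
by rewrite lerBlDl.
Qed.

Lemma lin_comp f g a b c : lin g a b -> lin f b c -> lin (f \o g) a c.
Proof.
move=> h h' x hx; rewrite /= (h' _ (lin_range h hx)) (h _ hx).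
by field; rewrite !width_neq0.
Qed.

Lemma lin_inv f g a b : cancel f g -> lin f a b -> lin g b a.
Proof.
move=> fK h x /andP[h1 h2].
have ra : 0 < wd a / wd b by rewrite divr_gt0 ?width_gt0.
set y := RHS; suff -> : x = f y by rewrite fK.
rewrite h; first by rewrite /y; field; rewrite !width_neq0.
rewrite /y lerDl mulr_ge0 ?(ltW ra) ?subr_ge0 //= lerD2l.
rewrite -[leRHS](divfK (width_neq0 b)) ler_wpM2l ?(ltW ra) //.
by rewrite lerBlDl.
Qed.

Lemma lin_uniq f a b b' : lin f a b -> lin f a b' -> b = b'.
Proof.
move=> h h'; have l : lo b = lo b' by rewrite -(lin_lower h) (lin_lower h').
have u : upper R b = upper R b' by rewrite -(lin_upper h) (lin_upper h').
apply: (lower_width_inj l); apply: (@width_inj_size R).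
by move: u; rewrite /upper l => /addrI.
Qed.

Lemma lin_cat f a b w : lin f a b -> lin f (a ++ w) (b ++ w).
Proof.
move=> h x /andP[h1 h2]; rewrite h; last first.
  move: h1 h2; rewrite lower_cat upper_cat => h1 h2; apply/andP; split.
    by apply: le_trans h1; rewrite lerDl mulr_ge0 ?lower_ge0 ?(ltW (width_gt0 _ _)).
  apply: le_trans h2 _; rewrite lerD2l -[leRHS]mulr1.
  by rewrite ler_wpM2l ?upper_le1 ?(ltW (width_gt0 _ _)).
by rewrite !lower_cat !width_cat; field; rewrite !width_neq0.
Qed.

Lemma lin_rcons f a b (d : bool) : lin f a b -> lin f (rcons a d) (rcons b d).
Proof. by rewrite -!cats1; apply: lin_cat. Qed.

Lemma width_rcons a (d : bool) : wd (rcons a d) = wd a / 2%:R.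
Proof. by rewrite -cats1 width_cat width_cons width_nil mulrA mulr1. Qed.

Lemma lin_join f a b :
  lin f (rcons a false) (rcons b false) -> lin f (rcons a true) (rcons b true) ->
  lin f a b.
Proof.
move=> h0 h1 x /andP[l u].
have [xm|mx] := leP x (lo a + wd a / 2%:R).
  rewrite h0; last by rewrite lower_rcons upper_rcons /= mul0r !addr0 mul1r l.
  by rewrite !lower_rcons !width_rcons /=; field; rewrite width_neq0.
rewrite h1.
  by rewrite !lower_rcons !width_rcons /=; field; rewrite width_neq0.
rewrite lower_rcons upper_rcons /= mul1r ltW //=; apply: le_trans u _.
by rewrite /upper lerD2l; lra.
Qed.

Lemma eq_lin f g a b : (forall x, lo a <= x <= upper R a -> f x = g x) -> lin f a b -> lin g a b.
Proof. by move=> e h x hx; rewrite -e // h. Qed.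

Lemma ratio_exp a b : wd b / wd a = 2%:R ^ ((size a)%:Z - (size b)%:Z).
Proof.
by rewrite /width invrK expfzDr ?pnatr_eq0 // -exprnN -exprnP mulrC.
Qed.

Lemma affine_word (k : int) t : dyadic t ->
  exists N, forall a, (N <= size a)%N -> 0 <= 2%:R ^ k * lo a + t ->
    2%:R ^ k * upper R a + t <= 1 ->
    exists b, lo b = 2%:R ^ k * lo a + t /\ wd b = 2%:R ^ k * wd a.
Proof.
move=> /dyadic_grid[M hM]; exists (M + `|k|)%N => a ha h0 h1.
(* The image of the interval has length 2^-r. The choice of [N] gives M <= r, so the translation [t]
   lies on the grid of level [r]. *)
pose r : nat := `|(size a)%:Z - k|%N.
have hr : (r%:Z = (size a)%:Z - k) by rewrite /r; lia.
have Mr : (M <= r)%N by lia.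
have e (m : R) : 2%:R ^ k * (m / 2%:R ^+ size a) = m / 2%:R ^+ r.
  rewrite mulrCA; congr (_ * _); rewrite [2%:R ^+ r]exprnP hr expfzDr ?pnatr_eq0 //.
  by rewrite invfM -exprnP invr_expz opprK mulrC.
have ew : 2%:R ^ k * wd a = 2%:R ^- r.
  by have := e 1; rewrite !mul1r.
have hd : grid r (2%:R ^ k * lo a + t).
  apply: gridD; last exact: grid_leq hM.
  by have [m ->] := grid_lower R a; exists m; rewrite e.
have [|b sb lb] := word_at hd h0.
  apply: lt_le_trans h1; rewrite ltrD2r ltr_pM2l ?exprz_gt0 //.
  exact: lower_lt_upper.
by exists b; rewrite lb ew /width sb.
Qed.

Lemma dyadicB x y : dyadic x -> dyadic y -> dyadic (x - y).
Proof.
move=> /dyadic_grid[n hn] /dyadic_grid[m hm]; apply/dyadic_grid.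
exists (maxn n m); apply: gridB; first exact: grid_leq (leq_maxl n m) hn.
exact: grid_leq (leq_maxr n m) hm.
Qed.

Lemma dyadic0 : dyadic (0 : R).
Proof. by apply/dyadic_grid; exists 0%N; apply: grid0. Qed.

(** Induction on the breakpoints with a moving left end [c]. The translation parts are not assumed
    dyadic: that of the first piece is dyadic because [c] and [f c] are, and then the image of the
    next breakpoint is dyadic as well. *)
Lemma pl_words f s (c : R) : path <%R c s -> (forall d : R, d \in s -> dyadic d) ->
  dyadic c -> dyadic (f c) -> 0 <= c -> last c s <= 1 ->
  (forall x, 0 <= x <= 1 -> 0 <= f x <= 1) ->
  (forall i, (i < size s)%N -> exists (k : int) t, forall x,
     x \in `[nth 0 (c :: s) i, nth 0 s i] -> f x = 2%:R ^ k * x + t) ->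
  exists N, forall a, (N <= size a)%N -> c <= lo a -> upper R a <= last c s ->
    exists b, lin f a b.
Proof.
move=> hp hs hc hfc c0 l1 f01; elim: s c hp hs hc hfc c0 l1 => [|d s IH] c /=.
  move=> _ _ _ _ _ _ _; exists 0%N => a _ h1 h2; exfalso.
  by have := lower_lt_upper R a; rewrite ltNge (le_trans h2).
move=> /andP[cd hp] hs hc hfc c0 l1 hi.
have hd : dyadic d by apply: hs; rewrite mem_head.
have ds : d <= last d s.
  elim: (s) (d) hp => //= e s' IHs d' /andP[de /IHs]; exact: le_trans (ltW de).
have [k [t hk]] := hi 0%N isT; rewrite /= in hk.
have hkc : f c = 2%:R ^ k * c + t by apply: hk; rewrite in_itv /= lexx ltW.
have hkd : f d = 2%:R ^ k * d + t by apply: hk; rewrite in_itv /= lexx ltW.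
have scale x : dyadic x -> dyadic (2%:R ^ k * x).
  move=> [m [n ->]]; case: k {hk hkc hkd} => k.
    exists (m * 2 ^+ k), n; rewrite -exprnP rmorphM rmorphXn /= mulrA.
    by rewrite [_ ^+ k * _]mulrC.
  exists m, (k.+1 + n)%N; rewrite NegzE -exprnN exprD invfM mulrCA.
  by [].
have ht : dyadic t.
  have -> : t = f c - 2%:R ^ k * c by rewrite hkc addrC addKr.
  by apply: dyadicB => //; apply: scale.
have hfd : dyadic (f d).
  rewrite hkd -[t]opprK; apply: dyadicB; first exact: scale.
  by rewrite -sub0r; apply: dyadicB => //; apply: dyadic0.
have [N1 hN1] := IH d hp (fun e he => hs e (mem_behead (s := d :: s) he)) hd hfd
  (le_trans c0 (ltW cd)) l1 (fun i => hi i.+1).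
have [N2 hN2] := affine_word k ht.
have /dyadic_grid[N3 hN3] := hd.
exists (maxn N1 (maxn N2 N3)) => a; rewrite !geq_max => /and3P[a1 a2 a3] ca al.
(* A long word lies on one side of the breakpoint [d]; the right side is the induction
   hypothesis. *)
have /orP[ad|da] := grid_side hN3 a3; last exact: hN1.
have fa x : lo a <= x <= upper R a -> f x = 2%:R ^ k * x + t.
  move=> /andP[h1 h2]; apply: hk; rewrite in_itv /= (le_trans ca h1).
  by rewrite (le_trans h2 ad).
have la := lower_lt_upper R a.
have fl : f (lo a) = 2%:R ^ k * lo a + t by apply: fa; rewrite lexx ltW.
have fu : f (upper R a) = 2%:R ^ k * upper R a + t by apply: fa; rewrite lexx ltW.
have [|| b [lb wb]] := hN2 a a2.
- by rewrite -fl; have /andP[] := f01 _ (introT andP (conj (lower_ge0 R a) (ltW (lower_lt1 R a)))).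
- by rewrite -fu; have /andP[] := f01 _ (introT andP (conj (ltW (upper_gt0 R a)) (upper_le1 R a))).
exists b => x hx; rewrite fa // lb wb; field; exact: width_neq0.
Qed.

End Lin.

(** * Elements of F: endpoints, action on fine words, and pasting *)

Section ThompsonFacts.
Variable R : realType.
Implicit Types (a b w : seq bool) (x y z t : R) (f g h : R -> R).
Local Notation lo := (lower R).
Local Notation wd := (width R).

Lemma thompson_range f x : thompsonF f -> 0 <= x <= 1 -> 0 <= f x <= 1.
Proof.
by move=> [_ [hf _ _] _ _ _] hx; have := hf x; rewrite /= !in_itv /=; apply.
Qed.

Lemma thompson0 f : thompsonF f -> f 0 = 0.
Proof.
move=> hf; have [_ [_ _ sj] _ inc _] := hf.
have [|x] := sj 0; first by rewrite /= in_itv /= lexx ler01.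
rewrite /= in_itv /= => hx e; apply/eqP; rewrite eq_le.
have /andP[-> _] := thompson_range hf (x := 0) (introT andP (conj (lexx 0) ler01)).
rewrite andbT; have [x0|] := ltP 0 x.
  by rewrite ltW // -[ltRHS]e; apply: inc; rewrite // in_itv /= ?lexx ?ler01.
by move: hx => /andP[x0 _] x0'; rewrite -[leRHS]e (@le_anti _ _ x 0) // x0 x0'.
Qed.

Lemma thompson1 f : thompsonF f -> f 1 = 1.
Proof.
move=> hf; have [_ [_ _ sj] _ inc _] := hf.
have [|x] := sj 1; first by rewrite /= in_itv /= lexx ler01.
rewrite /= in_itv /= => hx e; apply/eqP; rewrite eq_le.
have /andP[_ ->] := thompson_range hf (x := 1) (introT andP (conj ler01 (lexx 1))).
rewrite /=; have [x0|] := ltP x 1.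
  by rewrite ltW // -[ltLHS]e; apply: inc; rewrite // in_itv /= ?lexx ?ler01.
by move: hx => /andP[_ x0] x0'; rewrite -[leLHS]e (@le_anti _ _ x 1) // x0 x0'.
Qed.

Lemma thompson_lt f x y : thompsonF f -> x < y -> f x < f y.
Proof.
move=> hf xy; have [out _ _ inc _] := hf.
have [hx|hx] := boolP (x \in `[0, 1]); have [hy|hy] := boolP (y \in `[0, 1]).
- exact: inc.
- rewrite (out y) //; move: hx hy; rewrite !in_itv /= => hx.
  have /andP[_ fx] := thompson_range hf hx.
  move: hx => /andP[x0 _]; rewrite negb_and -!ltNge => /orP[|]; first lra.
  exact: le_lt_trans.
- rewrite (out x) //; move: hx hy; rewrite !in_itv /= => hx hy.
  have /andP[fy _] := thompson_range hf hy.
  move: hy => /andP[_ y1]; move: hx; rewrite negb_and -!ltNge => /orP[|]; last lra.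
  by move=> /lt_le_trans; apply.
by rewrite !out.
Qed.

Lemma thompson_le f x y : thompsonF f -> (f x <= f y) = (x <= y).
Proof.
move=> hf; have [xy|yx] := leP x y.
  by move: xy; rewrite le_eqVlt => /orP[/eqP ->|/(thompson_lt hf)/ltW //]; rewrite lexx.
by rewrite leNgt thompson_lt.
Qed.

(** The form in which piecewise linearity is used from here on: beyond some level, words go to
    words. *)
Lemma thompson_words f : thompsonF f ->
  exists N, forall a, (N <= size a)%N -> exists b, lin f a b.
Proof.
move=> hf; have [_ _ _ _ [s [[hp hl] hs hi]]] := hf.
have [] := @pl_words R f s 0 hp hs (dyadic0 R) _ (lexx 0) _ _ hi.
- by rewrite thompson0 //; apply: dyadic0.
- by rewrite hl.
- by move=> x; apply: thompson_range.
by move=> N h; exists N => a ha; apply: h => //; rewrite ?hl ?lower_ge0 ?upper_le1.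
Qed.

Lemma chain_subdivision x ws y : chain x ws y ->
  let s := map (upper R) ws in
  [/\ path <%R x s, last x s = y &
      forall i, (i < size ws)%N -> nth 0 (x :: s) i = lo (nth [::] ws i)].
Proof.
elim: ws x => [|a ws IH] x /=; first by move=> ->.
move=> [<- /IH[hp hl hi]]; split => //; first by rewrite lower_lt_upper.
by case=> // i; apply: hi.
Qed.

(* The pieces of a map are read off at a uniform level, so that a uniform subdivision suffices. *)
Lemma words_pl f N : (forall a, size a = N -> exists b, lin f a b) ->
  exists s : seq R,
    [/\ subdivision s, (forall c, c \in s -> dyadic c) &
        on_pieces s (fun c d : R => exists (k : int) (t : R),
          forall x, x \in `[c, d] -> f x = 2%:R ^ k * x + t)].
Proof.
move=> h; have := chain_subd R N [::]; rewrite /= upper_nil => hc.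
have [hp hl hi] := chain_subdivision hc.
exists (map (upper R) (subd N [::])); split => //.
  by move=> _ /mapP[a _ ->]; apply: dyadic_upper.
move=> i; rewrite size_map => li; rewrite hi // (nth_map [::]) //.
set a := nth _ _ _; have [b hb] := h a (size_subd (mem_nth _ li)).
exists ((size a)%:Z - (size b)%:Z), (lo b - wd b / wd a * lo a) => x.
by rewrite in_itv /= => /hb ->; rewrite ratio_exp mulrBr addrCA addrA addrAC -addrA.
Qed.

Definition paste f g z x : R := if x <= z then f x else g x.

Lemma pasteL f g z x : x <= z -> paste f g z x = f x.
Proof. by rewrite /paste => ->. Qed.

Lemma pasteR f g z x : f z = g z -> z <= x -> paste f g z x = g x.
Proof. by rewrite /paste => e zx; case: (leP x z) => // xz; rewrite (@le_anti _ _ x z) ?xz. Qed.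

Lemma paste_thompson f g z : thompsonF f -> thompsonF g -> dyadic z -> 0 <= z <= 1 ->
  f z = g z -> thompsonF (paste f g z).
Proof.
move=> hf hg hz z01 e.
have gR x : z <= x -> paste f g z x = g x by apply: pasteR.
have gL x : x <= z -> paste f g z x = f x by apply: pasteL.
have inc x y : x < y -> paste f g z x < paste f g z y.
  move=> xy; have [yz|zy] := leP y z.
    by rewrite !gL ?(le_trans (ltW xy)) // thompson_lt.
  have [xz|zx] := leP x z; last by rewrite !gR ?ltW // thompson_lt.
  rewrite gL // gR ?(ltW zy) //; apply: le_lt_trans (_ : f z < _).
    by rewrite thompson_le.
  by rewrite e thompson_lt.
have g0 : paste f g z 0 = 0 by rewrite gL ?thompson0 //; case/andP: z01.
have g1 : paste f g z 1 = 1 by rewrite gR ?thompson1 //; case/andP: z01.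
have sj : set_surj `[0, 1] `[0, 1] (paste f g z).
  move=> y; rewrite /= in_itv /= => y01.
  have [_ [_ _ sf] _ _ _] := hf; have [_ [_ _ sg] _ _ _] := hg.
  have hy : `[0, 1]%classic y by rewrite /= in_itv.
  have [yz|zy] := leP y (f z).
    have [x hx ex] := sf y hy; exists x => //.
    by rewrite gL // -(thompson_le _ _ hf) ex.
  have [x hx ex] := sg y hy; exists x => //.
  by rewrite gR // -(thompson_le _ _ hg) ex -e ltW.
have mono : {mono paste f g z : x y / x <= y}.
  move=> x y; have [|yx] := leP x y; last by rewrite leNgt inc.
  by rewrite le_eqVlt => /orP[/eqP ->|/inc/ltW //]; rewrite lexx.
split.
- move=> x hx; rewrite /paste; case: ifP => _; [by case: hf => -> |by case: hg => ->].
- split=> //.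
    by move=> x; rewrite /= !in_itv /= => /andP[x0 x1]; rewrite -{1}g0 -{1}g1 !mono x0.
  by move=> x y _ _ exy; apply: le_anti; rewrite -(mono x y) -(mono y x) exy lexx.
(* An increasing surjection of intervals is continuous, so no gluing of continuity at [z] is
   required. *)
- apply: segment_inc_surj_continuous; first by move=> x y _ _; apply: mono.
  by rewrite g0 g1.
- by move=> x y _ _; apply: inc.
have [N1 h1] := thompson_words hf; have [N2 h2] := thompson_words hg.
move/dyadic_grid: hz => [N3 h3].
apply: (@words_pl _ (maxn N1 (maxn N2 N3))) => a ha.
have : (size a >= maxn N1 (maxn N2 N3))%N by rewrite ha.
rewrite !geq_max => /and3P[a1 a2 a3].
have /orP[az|za] := grid_side h3 a3.
  have [b hb] := h1 a a1; exists b; apply: eq_lin hb => x /andP[_ xu].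
  by rewrite gL // (le_trans xu).
have [b hb] := h2 a a2; exists b; apply: eq_lin hb => x /andP[xl _].
by rewrite gR // (le_trans za).
Qed.

Variable H : set (R -> R).
Hypotheses (H_sub : subgroupF H) (H_closed : closedF H).

Lemma subgroup_thompson f : H f -> thompsonF f.
Proof. by case: H_sub => + _ _ _; apply. Qed.

(** The subdivision 0 < z < 1 exhibits the pasted map as piecewise-[H]. Closedness enters all later
    arguments through this pasting. *)
Lemma paste_closed f g z : H f -> H g -> dyadic z -> 0 < z < 1 -> f z = g z ->
  H (paste f g z).
Proof.
move=> hf hg hz /andP[z0 z1] e; apply: H_closed.
  apply: paste_thompson => //; try exact: subgroup_thompson.
  by rewrite !ltW.
exists [:: z; 1]; first by split => //=; rewrite z0 z1.
case=> [|[|//]] _ /=.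
  by exists f => // x; rewrite in_itv /= => /andP[_ xz]; rewrite pasteL.
by exists g => // x; rewrite in_itv /= => /andP[xz _]; rewrite pasteR.
Qed.

End ThompsonFacts.

(** * Existence of reduced tree pairs *)

Section TreePairExistence.
Variable R : realType.
Implicit Types (a b w : seq bool) (ws bs : seq (seq bool)) (x y z : R) (t : tree) (f g h : R -> R).
Local Notation lo := (lower R).
Local Notation wd := (width R).

Fixpoint lin_all f ws bs : Prop :=
  match ws, bs with
  | a :: ws', b :: bs' => lin f a b /\ lin_all f ws' bs'
  | [::], [::] => True
  | _, _ => False
  end.

Lemma lin_all_cat f ws1 ws2 bs1 bs2 : size ws1 = size bs1 ->
  lin_all f (ws1 ++ ws2) (bs1 ++ bs2) <-> lin_all f ws1 bs1 /\ lin_all f ws2 bs2.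
Proof.
elim: ws1 bs1 => [|a ws1 IH] [|b bs1] //= => [_|[/IH->]]; last tauto.
by split=> [|[]].
Qed.

Lemma lin_all_nth f ws bs : lin_all f ws bs <->
  size ws = size bs /\
  forall i, (i < size ws)%N -> lin f (nth [::] ws i) (nth [::] bs i).
Proof.
elim: ws bs => [|a ws IH] [|b bs] //=; try by split=> // -[].
rewrite IH; split=> [[h [-> hi]]|[[->] hi]]; first by split=> // -[].
by split; [exact: (hi 0%N)|split=> // i; exact: (hi i.+1)].
Qed.

Lemma chain_lin f x ws y : {in ws, forall a, exists b, lin f a b} -> chain x ws y ->
  exists2 bs, lin_all f ws bs & chain (f x) bs (f y).
Proof.
elim: ws x => [|a ws IH] x hs /=; first by move=> ->; exists [::].
move=> [<- /IH []]; first by move=> c hc; apply: hs; rewrite in_cons hc orbT.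
move=> bs hb hc; have [b hab] := hs a (mem_head _ _).
by exists (b :: bs) => //=; rewrite -(lin_lower hab) -(lin_upper hab).
Qed.

Lemma chain_halfR x ws : [::] \notin ws -> 2%:R^-1 <= x -> chain x ws 1 ->
  exists2 rs, ws = map (cons true) rs & chain (2%:R * x - 1) rs 1.
Proof.
elim: ws x => [|a ws IH] x /=; first by exists [::] => //=; lra.
rewrite in_cons negb_or => /andP[na nw] x2 [la h].
case: a na la h => // -[] a _ /= la h; last first.
  by have := lower_lt1 R a; move: la x2; rewrite /=; lra.
have [|||rs -> hr] := IH (upper R (true :: a)) => //.
  by rewrite upper_cons; have := upper_gt0 R a; rewrite /=; lra.
exists (a :: rs) => //=; split; first by rewrite -la /=; lra.
by move: hr; rewrite upper_cons; congr chain; rewrite /=; lra.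
Qed.

(** A nonempty word has its interval in one half of [0,1], so a chain without the root word breaks
    at 1/2. Rescaling the halves prepares the recursion on the two subtrees. *)
Lemma chain_half x ws : [::] \notin ws -> x <= 2%:R^-1 -> chain x ws 1 ->
  exists ls rs, [/\ ws = map (cons false) ls ++ map (cons true) rs,
    chain (2%:R * x) ls 1 & chain (0 : R) rs 1].
Proof.
elim: ws x => [|a ws IH] x /=; first by move=> _ ? ?; exfalso; lra.
rewrite in_cons negb_or => /andP[na nw] x2 [la h].
case: a na la h => // -[] a _ /= la h.
  have x2' : x = 2%:R^-1 by have := lower_ge0 R a; move: la x2; rewrite /=; lra.
  have [|||rs e hr] := @chain_halfR x ((true :: a) :: ws) => //.
    by rewrite x2'.
  exists [::], rs; split=> //=; first by rewrite x2' mulfV.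
  by move: hr; congr chain; rewrite x2' mulfV // subrr.
have [|||ls [rs [-> hl hr]]] := IH (upper R (false :: a)) => //.
  by rewrite upper_cons; have := upper_le1 R a; rewrite /=; lra.
exists (a :: ls), rs; split=> //=; split; first by rewrite -la /=; lra.
by move: hl; rewrite upper_cons; congr chain; rewrite /=; lra.
Qed.

(** Induction on the maximal word length: the chain is the root word alone, or it splits at 1/2 into
    the leaf lists of two subtrees. *)
Lemma chain_tree ws : chain (0 : R) ws 1 -> exists t, leaves t = ws.
Proof.
have [n] : exists n, {in ws, forall a, (size a <= n)%N}.
  elim: ws => [|a ws [n hn]]; first by exists 0%N.
  exists (maxn (size a) n) => b; rewrite in_cons => /orP[/eqP ->|/hn hb].
    exact: leq_maxl.
  by rewrite (leq_trans hb) ?leq_maxr.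
elim: n ws => [|n IH] [|a ws] hn; try by move=> /= /eqP; rewrite eq_sym oner_eq0.
  have /size0nil -> : size a = 0%N by apply/eqP; rewrite -leqn0 hn ?mem_head.
  move=> [_]; rewrite upper_nil; case: ws {hn} => [_|b ws [e _]]; first by exists Leaf.
  by exfalso; have := lower_lt1 R b; rewrite e ltxx.
move=> h; have [nw|] := boolP ([::] \notin a :: ws).
  have [|ls [rs [e hl hr]]] := chain_half nw _ h; first by rewrite invr_ge0.
  rewrite mulr0 in hl; rewrite e.
  have [|l <-] := IH ls _ hl.
    move=> b hb; have /hn // : false :: b \in a :: ws.
    by rewrite e mem_cat mem_map ?hb // => ? ? [].
  have [|r <-] := IH rs _ hr; last by exists (Node l r).
  move=> b hb; have /hn // : true :: b \in a :: ws.
  by rewrite e mem_cat [X in _ || X]mem_map ?hb ?orbT // => ? ? [].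
rewrite negbK in_cons => /orP[/eqP e|].
  move: h; rewrite -e => -[_]; rewrite upper_nil.
  case: ws {hn} => [_|b ws [e' _]]; first by exists Leaf.
  by exfalso; have := lower_lt1 R b; rewrite e' ltxx.
(* A root word in a later position would start at 0, whereas it must start at the positive right end
   of its predecessor. *)
move=> hw; exfalso; case: h => _; have := upper_gt0 R a.
elim: ws (upper R a) hw {hn IH} => // b ws IH x; rewrite in_cons => /orP[/eqP <-|hw].
  by move=> x0 [e _]; move: x0; rewrite -e ltxx.
by move=> x0 [_ /IH]; apply=> //; apply: upper_gt0.
Qed.

Lemma chain_map_cons (d : bool) x ws y :
  chain x ws y -> chain ((d%:R + x) / 2%:R) (map (cons d) ws) ((d%:R + y) / 2%:R).
Proof.
elim: ws x => [|a ws IH] x /=; first by move=> ->.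
by move=> [<- /IH]; rewrite upper_cons.
Qed.

Lemma chain_leaves t : chain (0 : R) (leaves t) 1.
Proof.
elim: t => [|l IHl r IHr] /=; first by rewrite upper_nil.
apply: chain_cat (_ : chain _ _ 2%:R^-1) _.
  by have := chain_map_cons false IHl; congr chain; rewrite /=; lra.
by have := chain_map_cons true IHr; congr chain; rewrite /=; lra.
Qed.

Lemma chain_catE x ws ws' z : chain x (ws ++ ws') z ->
  exists2 y, chain x ws y & chain y ws' z.
Proof.
elim: ws x => [|a ws IH] x /=; first by exists x.
by move=> [<- /IH[y h h']]; exists y.
Qed.

Lemma chain_merge x ws ws' a y :
  chain x (ws ++ rcons a false :: rcons a true :: ws') y -> chain x (ws ++ a :: ws') y.
Proof.
move=> /chain_catE[z h [h1 [_ h2]]]; apply: chain_cat h _.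
split; first by rewrite -h1 lower_rcons mul0r addr0.
by move: h2; congr chain; rewrite upper_rcons /upper /=; lra.
Qed.

Lemma representsE (P : tree * tree) g :
  represents P g <-> lin_all g (leaves P.1) (leaves P.2).
Proof.
by rewrite lin_all_nth /represents; split=> -[e h]; split.
Qed.

Lemma sibling_split t i : sibling_leaves t i -> exists a ws ws',
  leaves t = ws ++ rcons a false :: rcons a true :: ws' /\ size ws = i.
Proof.
move=> [hi [a [e0 e1]]]; exists a, (take i (leaves t)), (drop i.+2 (leaves t)).
rewrite size_take (ltn_trans _ hi) //; split=> //.
rewrite -{1}(cat_take_drop i (leaves t)); congr (_ ++ _).
by rewrite (drop_nth [::]) ?(ltn_trans _ hi) // e0 (drop_nth [::]) // e1.
Qed.

(** A uniform subdivision fine enough for [f] gives some tree pair. While a common pair of sibling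
    leaves remains, merging it on both sides keeps the map affine there and shortens the leaf lists,
    so this terminates. *)
Lemma reduced_pair f : thompsonF f -> exists2 P : tree * tree, represents P f & reduced P.
Proof.
move=> hf; have [N hN] := thompson_words hf.
have h0 := chain_subd R N [::]; rewrite /= upper_nil in h0.
have [|bs hb hc] := chain_lin _ h0 (f := f).
  by move=> a /size_subd ha; apply: hN; rewrite ha.
rewrite thompson0 // thompson1 // in hc.
have [[t et] [t' et']] := (chain_tree h0, chain_tree hc).
have : represents (t, t') f by apply/representsE; rewrite et et'.
have [n] := ubnP (size (leaves t)); elim: n t t' {et et'} => // n IH t t' hn hr.
have [hred|] := pselect (reduced (t, t')); first by exists (t, t').
move=> /existsNP[i /contrapT [/sibling_split[a [ws [ws' [e1 s1]]]]]].
move=> /sibling_split[a' [us [us' [e2 s2]]]].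
have [u eu] : exists u, leaves u = ws ++ a :: ws'.
  by apply/chain_tree/chain_merge; rewrite -e1; apply: chain_leaves.
have [u' eu'] : exists u, leaves u = us ++ a' :: us'.
  by apply/chain_tree/chain_merge; rewrite -e2; apply: chain_leaves.
apply: (IH u u').
  by move: hn; rewrite /= in e1; rewrite e1 eu !size_cat /=; lia.
move/representsE: hr; rewrite e1 e2 lin_all_cat ?s1 // => -[h1 [h2 [h3 h4]]].
apply/representsE; rewrite eu eu' lin_all_cat ?s1 //; split=> //; split=> //.
exact: lin_join.
Qed.

End TreePairExistence.

(** * The core in terms of words, and path classes as orbits of pairs of points *)

Scheme same_edge_mut := Minimality for same_edge Sort Prop
  with same_cell_mut := Minimality for same_cell Sort Prop.

Section LinEquiv.
Variables (R : realType) (H : set (R -> R)).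
Hypotheses (H_sub : subgroupF H) (H_closed : closedF H).
Implicit Types (a b : seq bool) (x y : R).

(** This relation will turn out to be equality of the edges named by the two words. *)
Definition lin_equiv a b : Prop := exists2 h, H h & lin h a b.

Lemma lin_equiv_refl a : lin_equiv a a.
Proof. by exists id; [case: H_sub|apply: lin_id]. Qed.

Lemma lin_equiv_sym a b : lin_equiv a b -> lin_equiv b a.
Proof.
move=> [h hH hl]; have [_ _ _ /(_ _ hH)[g [gH hK _]]] := H_sub.
by exists g => //; apply: lin_inv hl.
Qed.

Lemma lin_equiv_trans a b c : lin_equiv a b -> lin_equiv b c -> lin_equiv a c.
Proof.
move=> [h hH hl] [g gH gl]; have [_ _ comp _] := H_sub.
by exists (g \o h); [apply: comp|apply: lin_comp hl gl].
Qed.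

Lemma lin_equiv_rcons a b (d : bool) : lin_equiv a b -> lin_equiv (rcons a d) (rcons b d).
Proof. by move=> [h hH hl]; exists h => //; apply: lin_rcons. Qed.

(** The counterpart of folding along bottom paths: the two elements agree at the midpoint of [a] and
    are pasted there. *)
Lemma lin_equiv_join a b :
  lin_equiv (rcons a false) (rcons b false) -> lin_equiv (rcons a true) (rcons b true) ->
  lin_equiv a b.
Proof.
move=> [h hH hl] [g gH gl]; set z := upper R (rcons a false).
have ez : lower R (rcons a true) = z.
  by rewrite /z upper_rcons lower_rcons /=; ring.
have ez' : lower R (rcons b true) = upper R (rcons b false).
  by rewrite upper_rcons lower_rcons /=; ring.
have e : h z = g z by rewrite (lin_upper hl) -ez (lin_lower gl) ez'.
exists (paste h g z).
  apply: paste_closed => //; first by apply: dyadic_upper.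
  by rewrite upper_gt0 /= -ez lower_lt1.
apply: lin_join.
  by apply: eq_lin hl => x /andP[_ xu]; rewrite pasteL.
by apply: eq_lin gl => x /andP[xl _]; rewrite pasteR // -ez.
Qed.

Definition same_orbit x y : Prop := exists2 h, H h & h x = y.

Lemma same_orbit_refl x : same_orbit x x.
Proof. by exists id => //; case: H_sub. Qed.

Lemma same_orbit_sym x y : same_orbit x y -> same_orbit y x.
Proof.
move=> [h hH <-]; have [_ _ _ /(_ _ hH)[g [gH hK _]]] := H_sub.
by exists g.
Qed.

Lemma same_orbit_trans x y z : same_orbit x y -> same_orbit y z -> same_orbit x z.
Proof.
move=> [h hH <-] [g gH <-]; have [_ _ comp _] := H_sub.
by exists (g \o h) => //; apply: comp.
Qed.

Hypothesis H_minimal : minimal_action H.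

Lemma dense_orbit w x y : 0 < w < 1 -> 0 <= x -> x < y -> y <= 1 ->
  exists2 h, H h & x < h w < y.
Proof.
move=> w01 x0 xy y1; have hw : w \in `]0, 1[ by rewrite in_itv.
have hm : `]0, 1[%classic ((x + y) / 2%:R).
  by rewrite /= in_itv /=; apply/andP; split; lra.
have [|_ [[h hH <-]]] := H_minimal hw hm (B := [set` `]x, y[]).
  by apply: near_in_itvoo; rewrite in_itv /=; apply/andP; split; lra.
by rewrite /= in_itv /= => hx; exists h.
Qed.

End LinEquiv.

(** * Reading words and elements of [H] in the core *)

Section CoreWords.
Local Open Scope quotient_scope.
Variables (R : realType) (H X : set (R -> R)).
Hypotheses (H_sub : subgroupF H) (H_closed : closedF H).
Hypothesis X_gen : generates X H.
Implicit Types (a b w : seq bool) (e : pre_edge X) (c : pre_cell X).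
Implicit Types (f g h : R -> R).

Definition addr e : seq bool := if e is Some v then tv_addr v else [::].

Definition child c (d : bool) : pre_edge X := if d then right_child c else left_child c.

Lemma addr_child c d : addr (child c d) = rcons (pc_addr c) d.
Proof. by case: d. Qed.

Lemma same_cell_child c c' d : same_cell c c' -> same_edge (child c d) (child c' d).
Proof. by case: d; [apply: same_cell_right|apply: same_cell_left]. Qed.

(** Each rule respects addresses: leaves are glued by the generator itself, folding along tops
    restricts to halves, and folding along bottoms is [lin_equiv_join]. Edges and cells need a joint
    induction. *)
Lemma same_edge_lin_equiv e e' : same_edge e e' -> lin_equiv H (addr e) (addr e').
Proof.
apply: (@same_edge_mut R X (fun e e' => lin_equiv H (addr e) (addr e'))
  (fun c c' => lin_equiv H (pc_addr c) (pc_addr c'))) => {e e'}.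
- by move=> *; apply: lin_equiv_refl.
- by move=> *; apply: lin_equiv_sym.
- by move=> ? y ? _ h _ h'; apply: lin_equiv_trans h h'.
- by move=> v /= ->; apply: lin_equiv_refl.
- move=> v v' i _ _ _ hi /= -> ->.
  have [_ hl] := diag_rep (tv_diag v).
  exists (diag_elt (tv_diag v)); first by have [XH _] := X_gen; apply: XH; apply: diag_gen.
  by move=> x hx; apply: hl; rewrite // /tree_interval /= in_itv.
- by [].
- by move=> c c' _; rewrite !(addr_child _ false); apply: lin_equiv_rcons.
- by move=> c c' _; rewrite !(addr_child _ true); apply: lin_equiv_rcons.
- by move=> *; apply: lin_equiv_refl.
- by move=> *; apply: lin_equiv_sym.
- by move=> ? y ? _ h _ h'; apply: lin_equiv_trans h h'.
- by [].
move=> c c' _; rewrite !(addr_child _ false) => h0 _; rewrite !(addr_child _ true) => h1.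
exact: lin_equiv_join.
Qed.

(** The core run as an automaton: a letter leads from the top edge of a cell to its left or right
    bottom edge. Pre-edges up to [same_edge] are used in place of the quotient. *)
Fixpoint reads e w e' : Prop :=
  if w is d :: w' then exists2 c, same_edge e (parent c) & reads (child c d) w' e'
  else same_edge e e'.

Lemma reads_samel e1 e2 w e : same_edge e1 e2 -> reads e1 w e -> reads e2 w e.
Proof.
case: w => [|d w] /= h; first by apply: same_edge_trans; apply: same_edge_sym.
by move=> [c h' hw]; exists c => //; apply: same_edge_trans (same_edge_sym h) h'.
Qed.

Lemma reads_samer e w e1 e2 : same_edge e1 e2 -> reads e w e1 -> reads e w e2.
Proof.
move=> h; elim: w e => [|d w IH] e /=; first by move=> h'; apply: same_edge_trans h' h.
by move=> [c h' /IH hw]; exists c.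
Qed.

(** Folding along top paths makes the automaton deterministic. *)
Lemma reads_det e w e1 e2 : reads e w e1 -> reads e w e2 -> same_edge e1 e2.
Proof.
elim: w e => [|d w IH] e /=.
  by move=> h h'; apply: same_edge_trans (same_edge_sym h) h'.
move=> [c hc hw] [c' hc' hw']; apply: IH hw _; apply: reads_samel hw'.
by apply/same_cell_child/fold_top/(same_edge_trans (same_edge_sym hc') hc).
Qed.

Lemma reads_cat e w w' e1 e2 : reads e w e1 -> reads e1 w' e2 -> reads e (w ++ w') e2.
Proof.
elim: w e => [|d w IH] e /=; first by move=> /same_edge_sym h; apply: reads_samel.
by move=> [c hc hw] h; exists c => //; apply: IH.
Qed.

Lemma reads_catE e w w' e2 : reads e (w ++ w') e2 ->
  exists2 e1, reads e w e1 & reads e1 w' e2.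
Proof.
elim: w e => [|d w IH] e /=; first by exists e => //; apply: same_edge_refl.
by move=> [c hc /IH[e1 h h']]; exists e1 => //; exists c.
Qed.

Lemma reads_rcons e w c d : reads e w (parent c) -> reads e (rcons w d) (child c d).
Proof.
move=> h; rewrite -cats1; apply: reads_cat h _ => /=.
by exists c; apply: same_edge_refl.
Qed.

Lemma reads_rconsE e w d e' : reads e (rcons w d) e' ->
  exists2 c, reads e w (parent c) & same_edge (child c d) e'.
Proof.
by rewrite -cats1 => /reads_catE[e1 h [c h1 h2]]; exists c => //; apply: reads_samer h.
Qed.

Lemma nodes_rcons t a (d : bool) : rcons a d \in nodes t -> a \in carets t.
Proof.
elim: t a => [|l IHl r IHr] a; first by case: a.
case: a => [|b a]; first by rewrite in_cons.
rewrite rcons_cons mem_nodes_cons => h; rewrite in_cons /= mem_cat !mem_map_cons.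
by case: b h => [/IHr ->|/IHl ->]; rewrite ?orbT.
Qed.

Lemma reads_tv (v : tree_vertex X) : reads None (tv_addr v) (Some v).
Proof.
have [a ea] : exists a, a = tv_addr v by exists (tv_addr v).
rewrite -ea; elim/last_ind: a v ea => [|a d IH] v ea; first exact: glue_roots.
have ha : a \in carets (side (tv_diag v) (tv_side v)).
  by apply: (@nodes_rcons _ _ d); rewrite ea; apply: tv_mem.
have -> : Some v = child (PreCell ha) d.
  case: v ea ha => D s b hb /= ea ha; rewrite /child /right_child /left_child /=.
  by case: d {IH} ea => ea; congr Some; move: hb; rewrite -ea => hb; congr TreeVertex; apply: bool_irrelevance.
by apply: reads_rcons; apply: IH.
Qed.

Lemma reads_addr e : reads None (addr e) e.
Proof. by case: e => [v|]; [apply: reads_tv|apply: same_edge_refl]. Qed.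

Lemma reads_lin_equiv a e : reads None a e -> lin_equiv H a (addr e).
Proof.
elim/last_ind: a e => [|a d IH] e; first exact: same_edge_lin_equiv.
move=> /reads_rconsE[c /IH h /same_edge_lin_equiv]; rewrite addr_child.
apply: lin_equiv_trans => //; exact: lin_equiv_rcons.
Qed.

(* [accepted f a] says that the part of a tree pair of [f] below [a] can be read off in the core. *)
Inductive accepted f : seq bool -> Prop :=
| accepted_leaf a b e :
    reads None a e -> reads None b e -> lin f a b -> accepted f a
| accepted_node a :
    accepted f (rcons a false) -> accepted f (rcons a true) -> accepted f a.

Lemma reads_join a e0 e1 : reads None (rcons a false) e0 -> reads None (rcons a true) e1 ->
  exists c, [/\ reads None a (parent c), same_edge (child c false) e0 &
                same_edge (child c true) e1].
Proof.
move=> /reads_rconsE[c h0 h1] /reads_rconsE[c' h0' h1']; exists c; split=> //.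
apply: same_edge_trans h1'; apply/same_cell_child/fold_top.
exact: reads_det h0 h0'.
Qed.

Lemma acceptedE f a : accepted f a ->
  (exists b e, [/\ reads None a e, reads None b e & lin f a b]) \/
  (accepted f (rcons a false) /\ accepted f (rcons a true)).
Proof. by case=> {a} [a b e ha hb hl|a h h']; [left; exists b, e|right]. Qed.

(** Here folding along bottom paths is used: once the halves of [a] and of [b] end in the same
    edges, so do [a] and [b]. *)
Lemma accepted_lin f a b : accepted f a -> lin f a b ->
  exists2 e, reads None a e & reads None b e.
Proof.
move=> hf; elim: hf b => {a} [a b e ha hb hl b' hl'|a _ IH0 _ IH1 b hl].
  by exists e => //; rewrite -(lin_uniq hl hl').
have [e0 a0 b0] := IH0 _ (lin_rcons hl).
have [e1 a1 b1] := IH1 _ (lin_rcons hl).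
have [c [hc c0 c1]] := reads_join a0 a1; have [c' [hc' c0' c1']] := reads_join b0 b1.
exists (parent c) => //; apply: reads_samer hc'; apply/same_cell_parent/fold_bot.
  exact: same_edge_trans c0' (same_edge_sym c0).
exact: same_edge_trans c1' (same_edge_sym c1).
Qed.

Lemma accepted_readable f a : accepted f a -> exists e, reads None a e.
Proof.
elim=> {a} [a b e ha _ _|a _ [e0 h0] _ [e1 h1]]; first by exists e.
by have [c [hc _ _]] := reads_join h0 h1; exists (parent c).
Qed.

(** Below a leaf of the accepting tree, a readable letter can be read on the source and the image
    side alike, since both words end in the same edge. *)
Lemma accepted_below f a e : accepted f [::] -> reads None a e -> accepted f a.
Proof.
move=> h0; elim/last_ind: a e => [//|a d IH] e /reads_rconsE[c hc _].
have := IH _ hc; move: hc => /[swap]; case=> {a IH} [a b e' ha hb hl hc|a h h' _]; last by case: d.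
have ec := reads_det ha hc.
apply: (@accepted_leaf _ _ (rcons b d) (child c d)).
- exact: reads_rcons.
- by apply: reads_rcons; apply: reads_samer hb.
exact: lin_rcons.
Qed.

(** Induction on the tree for [g]. At a leaf [a] carried to [b], the tree for [f] below [b] is
    copied below [a], which is possible because both words end in the same edge. *)
Lemma accepted_comp f g a : accepted f [::] -> accepted g a -> accepted (f \o g) a.
Proof.
move=> h0; elim=> {a} [a b e ha hb hl|a _ h _ h']; last exact: accepted_node.
have := accepted_below h0 hb => hf.
elim: hf a e ha hb hl => {b} [b b1 e1 hb1 h1 l1|b hf0 IH0 hf1 IH1] a e ha hb hl.
  apply: (accepted_leaf ha _ (lin_comp hl l1)).
  by apply: reads_samer h1; apply: reads_det hb1 hb.
have [e0 r0] := accepted_readable hf0; have [c hc _] := reads_rconsE r0.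
have ec := reads_det hb hc; have hac := reads_samer ec ha.
apply: accepted_node.
  exact: IH0 _ _ (reads_rcons false hac) (reads_rcons false hc) (lin_rcons hl).
exact: IH1 _ _ (reads_rcons true hac) (reads_rcons true hc) (lin_rcons hl).
Qed.

Lemma accepted_tree f t : (forall a, a \in leaves t -> accepted f a) -> accepted f [::].
Proof.
suff h p : (forall a, a \in leaves t -> accepted f (p ++ a)) -> accepted f p.
  exact: (h [::]).
elim: t p => [|l IHl r IHr] p h; first by rewrite -[p]cats0; apply: h; rewrite inE.
apply: accepted_node; [apply: IHl|apply: IHr] => a ha; rewrite cat_rcons; apply: h.
  by rewrite /= mem_cat mem_map_cons ha.
by rewrite /= mem_cat orbC mem_map_cons ha.
Qed.

(** Acceptance of the inverse is built in, which makes closure under inverses immediate. Once the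
    generators are seen to belong to this subgroup, it is all of [H]. *)
Lemma accepted_subgroup : subgroupF [set f | H f /\ exists g, [/\ H g, cancel f g, cancel g f, accepted f [::] & accepted g [::]]].
Proof.
have [sub hid comp hinv] := H_sub.
have aid : accepted id [::].
  by apply: (@accepted_leaf _ _ [::] None); [apply: same_edge_refl|apply: same_edge_refl|apply: lin_id].
split.
- by move=> f [/sub].
- by split=> //; exists id.
- move=> f1 f2 [h1 [g1 [H1 c1 d1 a1 b1]]] [h2 [g2 [H2 c2 d2 a2 b2]]].
  split; first exact: comp.
  exists (g2 \o g1); split; [exact: comp|exact: can_comp|exact: can_comp| |].
    exact: accepted_comp.
  exact: accepted_comp.
by move=> f [hf [g [hg c d a b]]]; exists g; split=> //; split=> //; exists f.
Qed.

(** Corresponding leaves are glued, so one edge is read along both; exchanging the two trees treats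
    the inverse. *)
Lemma generator_accepted f g (D : diagram X) : diag_elt D = f -> cancel f g ->
  accepted f [::] /\ accepted g [::].
Proof.
move=> eD hc; have [es hl] := diag_rep D; rewrite eD in hl.
have key i : (i < size (leaves (side D true)))%N ->
    let a := nth [::] (leaves (side D true)) i in
    let b := nth [::] (leaves (side D false)) i in
    exists e, [/\ reads None a e, reads None b e & lin f a b].
  move=> hi a b.
  have ha : a \in nodes (side D true) by rewrite mem_cat orbC mem_nth.
  have hb : b \in nodes (side D false) by rewrite mem_cat orbC mem_nth //= -es.
  exists (Some (TreeVertex hb)); split.
  - apply: reads_samer (reads_tv (TreeVertex ha)).
    exact: (@glue_leaves _ _ (TreeVertex ha) (TreeVertex hb) i).
  - exact: (reads_tv (TreeVertex hb)).
  - by move=> x hx; apply: hl; rewrite // /tree_interval /= in_itv.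
split.
  apply: (@accepted_tree _ (side D true)) => a ha.
  have hi : (index a (leaves (side D true)) < size (leaves (side D true)))%N.
    by rewrite index_mem.
  have [e [h1 h2 h3]] := key _ hi.
  by rewrite nth_index // in h1 h3; apply: accepted_leaf h1 h2 h3.
apply: (@accepted_tree _ (side D false)) => b hb.
have hi : (index b (leaves (side D false)) < size (leaves (side D true)))%N.
  by rewrite /= es index_mem.
have [e [h1 h2 h3]] := key _ hi.
by rewrite nth_index // in h2 h3; apply: accepted_leaf h2 h1 (lin_inv hc h3).
Qed.

Lemma subgroup_accepted h : H h -> accepted h [::].
Proof.
have [XH hK] := X_gen; have [sub _ _ hinv] := H_sub.
move=> hh; have [//|_ [g [_ _ _ ? _]] //] := hK _ accepted_subgroup _ _ hh.
move=> f fX; have fH := XH f fX; split=> //.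
have [g [gH fK gK]] := hinv f fH; exists g.
have [P hr hred] := reduced_pair (sub _ fH).
by have [] := @generator_accepted f g (Diagram fX hr hred) erefl fK.
Qed.

Lemma lin_equiv_same_edge a b e e' :
  lin_equiv H a b -> reads None a e -> reads None b e' -> same_edge e e'.
Proof.
move=> [h hH hl] ra rb.
have [e1 ra1 rb1] := accepted_lin (accepted_below (subgroup_accepted hH) ra) hl.
exact: same_edge_trans (reads_det ra ra1) (reads_det rb1 rb).
Qed.

Hypothesis H_minimal : minimal_action H.

(* An interval below which nothing can be read is mapped by every element onto a dyadic
   interval of the same kind, so its points have discrete orbits in it. *)
Lemma reads_child a e : reads None a e -> exists c, same_edge e (parent c).
Proof.
move=> ra; apply: contrapT => stuck.
have stuck' b : reads None b e -> forall d w e', ~ reads None (b ++ d :: w) e'.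
  move=> rb d w e' /reads_catE[e1 rb1 [c h _]]; apply: stuck; exists c.
  by apply: same_edge_trans h; apply: reads_det rb rb1.
set x := upper R (rcons a false).
have ex : x = lower R a + width R a / 2%:R.
  by rewrite /x upper_rcons addr0 mul1r.
have wa := width_gt0 R a.
have xa : lower R a <= x <= upper R a.
  by rewrite ex /upper; apply/andP; split; lra.
(* Minimality moves the midpoint [x] of [a] into the open right half of the same interval. *)
have [||||h hH /andP[xh hu]] := @dense_orbit R H H_minimal x x (upper R a).
- by apply/andP; split; have := lower_ge0 R a; have := upper_le1 R a; rewrite ex /upper; lra.
- by rewrite (le_trans (lower_ge0 R a)) //; case/andP: xa.
- by rewrite ex /upper; lra.
- exact: upper_le1.
have ha : accepted h a by apply: accepted_below ra; apply: subgroup_accepted.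
case: (acceptedE ha) => [[b [e' [ra' rb hl]]]|[/accepted_readable[e0] + _]]; last first.
  by move=> /reads_rconsE[c rc _]; apply: stuck; exists c; apply: reads_det ra rc.
have wb := width_gt0 R b.
have hxb : h x = lower R b + width R b / 2%:R.
  by rewrite (hl _ xa) ex; field; rewrite gt_eqF.
(* The intervals of [a] and [b] overlap around [h x], so they are nested. A proper extension would
   be readable below a stuck edge, and equality would make [h x] the midpoint [x]. *)
have : prefix a b || prefix b a.
  apply: (@nested_prefix R); first by move: xh; rewrite hxb ex /upper; lra.
  by move: hu; rewrite hxb /upper; lra.
move=> /orP[] /prefixP[[|d w]]; rewrite ?cats0 => eab.
- by move: xh; rewrite hxb eab ex ltxx.
- by move: rb; rewrite eab => /(stuck' _ ra).
- by move: xh; rewrite hxb -eab ex ltxx.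
have rb' := reads_samer (reads_det ra' ra) rb.
by move: ra'; rewrite eab => /(stuck' _ rb').
Qed.

Lemma all_readable a : exists e, reads None a e.
Proof.
elim/last_ind: a => [|a d [e /[dup] ra /reads_child[c ec]]].
  by exists None; apply: same_edge_refl.
by exists (child c d); apply: reads_rcons; apply: reads_samer ra.
Qed.

(** * Vertices of the core as orbits of dyadic points *)

Definition point (x : endpoint X) : R :=
  if x.2 then upper R (addr x.1) else lower R (addr x.1).

Lemma lin_equiv_lower a b : lin_equiv H a b -> same_orbit H (lower R a) (lower R b).
Proof. by move=> [h hH hl]; exists h => //; apply: lin_lower. Qed.

Lemma lin_equiv_upper a b : lin_equiv H a b -> same_orbit H (upper R a) (upper R b).
Proof. by move=> [h hH hl]; exists h => //; apply: lin_upper. Qed.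

Lemma same_vertex_orbit x y : same_vertex x y -> same_orbit H (point x) (point y).
Proof.
elim=> {x y} [x|x y _|x y z _ h _ h'|e e' d|c|c|c].
- exact: same_orbit_refl.
- exact: same_orbit_sym.
- exact: same_orbit_trans h h'.
- move/same_edge_lin_equiv; rewrite /point /=.
  by case: d; [apply: lin_equiv_upper|apply: lin_equiv_lower].
- rewrite /point /= lower_rcons mul0r addr0; exact: same_orbit_refl.
- rewrite /point /=.
  have -> : lower R (rcons (pc_addr c) true) = upper R (rcons (pc_addr c) false).
    by rewrite upper_rcons lower_rcons /=; ring.
  exact: same_orbit_refl.
rewrite /point /=.
have -> : upper R (rcons (pc_addr c) true) = upper R (pc_addr c).
  by rewrite upper_rcons /upper /=; field.
exact: same_orbit_refl.
Qed.

Lemma same_vertex0 a e : reads None a e -> lower R a = 0 ->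
  same_vertex (e, false) (None, false).
Proof.
elim/last_ind: a e => [|a d IH] e.
  by move=> /= h _; apply/same_vertex_sym/same_edge_vertex.
move=> /reads_rconsE[c rc ec]; rewrite lower_rcons => l0.
have d0 : d = false.
  case: d l0 {ec} => // l0; have := width_gt0 R a; have := lower_ge0 R a.
  by move: l0; rewrite /=; lra.
move: l0 ec; rewrite d0 mul0r addr0 => l0 ec.
apply: same_vertex_trans (IH _ rc l0).
apply/same_vertex_sym; apply: same_vertex_trans (caret_ini c) _.
exact: same_edge_vertex.
Qed.

(** Trailing left turns do not change the initial vertex; at the last right turn, the left sibling
    ends where the word begins. Thus vertices other than the leftmost one can be studied as terminal
    endpoints. *)
Lemma ini_as_ter a e : reads None a e -> 0 < lower R a ->
  exists a' e', [/\ reads None a' e', upper R a' = lower R a &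
    same_vertex (e, false) (e', true)].
Proof.
elim/last_ind: a e => [|a d IH] e; first by rewrite /= ltxx.
move=> /reads_rconsE[c rc ec]; case: d ec => ec; last first.
  rewrite lower_rcons mul0r addr0 => /(IH _ rc)[a' [e' [h1 h2 h3]]].
  exists a', e'; split=> //; apply: same_vertex_trans h3; apply/same_vertex_sym.
  by apply: same_vertex_trans (caret_ini c) _; apply: same_edge_vertex.
move=> _; exists (rcons a false), (left_child c); split.
- exact: (reads_rcons false).
- by rewrite upper_rcons lower_rcons /=; ring.
apply/same_vertex_sym; apply: same_vertex_trans (caret_mid c) _.
exact: same_edge_vertex.
Qed.

(** Passing to right children lengthens the word and keeps its terminal vertex. *)
Lemma reads_extend a e n : reads None a e -> (size a <= n)%N ->
  exists a' e', [/\ reads None a' e', size a' = n, upper R a' = upper R a &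
    same_vertex (e, true) (e', true)].
Proof.
move=> ra /subnKC <-; elim: (n - size a)%N => [|k [a' [e' [h1 h2 h3 h4]]]].
  by exists a, e; rewrite addn0; split=> //; apply: same_vertex_refl.
have [c ec] := reads_child h1; exists (rcons a' true), (right_child c); split.
- by apply: (reads_rcons true); apply: reads_samer h1.
- by rewrite size_rcons h2 addnS.
- by rewrite -h3 upper_rcons /upper /=; field.
apply: same_vertex_trans h4 _; apply: same_vertex_trans (same_edge_vertex _ ec) _.
exact/same_vertex_sym/caret_ter.
Qed.

(** Extend [a] until [h] is affine on it: its image word [b1] names the same edge and ends where [b]
    ends. Extended to a common length, [b1] and [b] become the same word. *)
Lemma ter_orbit a b e e' : reads None a e -> reads None b e' ->
  same_orbit H (upper R a) (upper R b) -> same_vertex (e, true) (e', true).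
Proof.
move=> ra rb [h hH hu].
have [sub _ _ _] := H_sub; have [N hN] := thompson_words (sub _ hH).
have [a1 [e1 [ra1 sa1 ua1 sv]]] := reads_extend ra (leq_addr N (size a)).
apply: same_vertex_trans sv _.
have [|b1 hb1] := hN a1; first by rewrite sa1 leq_addl.
have [e1' rb1] := all_readable b1.
have s1 : same_edge e1 e1' by apply: lin_equiv_same_edge ra1 rb1; exists h.
apply: same_vertex_trans (same_edge_vertex _ s1) _.
have ub1 : upper R b1 = upper R b by rewrite -(lin_upper hb1) ua1.
have [b2 [e2 [rb2 sb2 ub2 sv2]]] := reads_extend rb1 (leq_addr (size b) (size b1)).
have [b3 [e3 [rb3 sb3 ub3 sv3]]] := reads_extend rb (leq_addl (size b1) (size b)).
have eb : b2 = b3.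
  apply: (@lower_width_inj R); last by rewrite sb2.
  have : upper R b2 = upper R b3 by rewrite ub2 ub3.
  by rewrite /upper /width sb2 sb3 => /addIr.
apply: same_vertex_trans sv2 _; apply: same_vertex_trans (same_vertex_sym sv3).
apply: same_edge_vertex; apply: reads_det rb2 _; by rewrite eb.
Qed.

(** Positive points are right ends of words, where [ter_orbit] applies. No interval ends at 0, but 0
    is fixed by [H] and can be handled apart. *)
Lemma orbit_same_vertex x y : same_orbit H (point x) (point y) -> same_vertex x y.
Proof.
have ter z : 0 < point z -> exists a e, [/\ reads None a e, upper R a = point z &
    same_vertex z (e, true)].
  case: z => e [] /=; rewrite /point /= => z0.
    by exists (addr e), e; split=> //; [apply: reads_addr|apply: same_vertex_refl].
  by have [a [e' [h1 h2 h3]]] := ini_as_ter (reads_addr e) z0; exists a, e'.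
have zero z : 0 = point z -> same_vertex z (None, false).
  case: z => e [] /=; rewrite /point /= => z0.
    by have := upper_gt0 R (addr e); rewrite -z0 ltxx.
  exact: same_vertex0 (reads_addr e) (esym z0).
have ge z : 0 <= point z.
  by rewrite /point; case: ifP => _; rewrite ?lower_ge0 ?(ltW (upper_gt0 _ _)).
move=> hxy; have [sub _ _ _] := H_sub.
have [x0|x0] := ltP 0 (point x); have [y0|y0] := ltP 0 (point y).
- have [a [e [ra ua /same_vertex_trans]]] := ter _ x0; apply.
  have [b [e' [rb ub /same_vertex_sym]]] := ter _ y0; apply: same_vertex_trans.
  by apply: ter_orbit ra rb _; rewrite ua ub.
- have [h hH e] := hxy; have := thompson_lt (sub _ hH) x0.
  by rewrite thompson0 ?e ?ltNge ?y0 //; apply: sub.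
- have [h hH e] := hxy; have := thompson_le (point x) 0 (sub _ hH).
  by rewrite thompson0 ?e ?x0 ?leNgt ?y0 //; apply: sub.
have ex : 0 = point x by apply/eqP; rewrite eq_le x0 ge.
have ey : 0 = point y by apply/eqP; rewrite eq_le y0 ge.
exact: same_vertex_trans (zero _ ex) (same_vertex_sym (zero _ ey)).
Qed.

(** * Edges, cells and vertices of the core named by words and points *)

Definition word_edge a : edge (core X) := \pi_(core_edge X) (sval (cid (all_readable a))).

Lemma reads_word_edge a e : reads None a e -> \pi_(core_edge X) e = word_edge a.
Proof.
move=> ra; apply/eqmodP/asboolP; case: cid => e' /= ra'.
exact: reads_det ra ra'.
Qed.

Lemma word_edge_eq a b : word_edge a = word_edge b <-> lin_equiv H a b.
Proof.
have [[e ra] [e' rb]] := (all_readable a, all_readable b).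
rewrite -(reads_word_edge ra) -(reads_word_edge rb); split.
  move=> /eqmodP/asboolP/same_edge_lin_equiv h.
  apply: lin_equiv_trans (reads_lin_equiv ra) _ => //.
  apply: lin_equiv_trans h _ => //; apply: lin_equiv_sym => //.
  exact: reads_lin_equiv.
move=> h; apply/eqmodP/asboolP; exact: lin_equiv_same_edge h ra rb.
Qed.

Lemma word_edge_surj (E : edge (core X)) : exists a, E = word_edge a.
Proof.
exists (addr (repr (E : core_edge X))); rewrite -(reads_word_edge (reads_addr _)).
by rewrite reprK.
Qed.

Lemma cell_words (c : cell (core X)) : exists a, top c = [:: word_edge a] /\
  bot c = [:: word_edge (rcons a false); word_edge (rcons a true)].
Proof.
pose pc := repr (c : core_cell X); exists (pc_addr pc).
rewrite -(reads_word_edge (reads_addr (parent pc))).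
rewrite -(reads_word_edge (reads_addr (left_child pc))).
by rewrite -(reads_word_edge (reads_addr (right_child pc))).
Qed.

Lemma word_cell a : exists c : cell (core X), top c = [:: word_edge a] /\
  bot c = [:: word_edge (rcons a false); word_edge (rcons a true)].
Proof.
have [e ra] := all_readable a; have [pc ec] := reads_child ra.
have rp := reads_samer ec ra.
pose c : core_cell X := \pi_(core_cell X) pc; exists c.
have hc : same_cell (repr c) pc.
  by apply/asboolP; have /eqmodP := reprK c.
have hp : \pi_(core_edge X) (parent (repr c)) = word_edge a.
  by rewrite -(reads_word_edge rp); apply/eqmodP/asboolP; apply: same_cell_parent.
have hl : \pi_(core_edge X) (left_child (repr c)) = word_edge (rcons a false).
  rewrite -(reads_word_edge (reads_rcons false rp)).
  by apply/eqmodP/asboolP; apply: same_cell_left.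
have hr : \pi_(core_edge X) (right_child (repr c)) = word_edge (rcons a true).
  rewrite -(reads_word_edge (reads_rcons true rp)).
  by apply/eqmodP/asboolP; apply: same_cell_right.
by rewrite -hp -hl -hr.
Qed.

Definition at_point (v : vertex (core X)) (x : R) : Prop :=
  exists2 p : endpoint X, v = \pi_(core_vertex X) p & same_orbit H (point p) x.

Lemma at_point_inj u v x : at_point u x -> at_point v x -> u = v.
Proof.
move=> [p -> hp] [q -> hq]; apply/eqmodP/asboolP; apply: orbit_same_vertex.
apply: same_orbit_trans hp _ => //; exact: same_orbit_sym.
Qed.

Lemma at_point_orbit v x y : at_point v x -> at_point v y -> same_orbit H x y.
Proof.
move=> [p -> hp] [q /eqmodP/asboolP/same_vertex_orbit hpq hq].
apply: same_orbit_trans (same_orbit_sym H_sub hp) _ => //.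
exact: same_orbit_trans hpq hq.
Qed.

Lemma orbit_at_point v x y : at_point v x -> same_orbit H x y -> at_point v y.
Proof. by move=> [p -> hp] h; exists p => //; apply: same_orbit_trans hp h. Qed.

Lemma at_ini a : at_point (ini (word_edge a)) (lower R a).
Proof.
have [e ra] := all_readable a; rewrite -(reads_word_edge ra).
exists (e, false); first exact: core_endpoint.
apply: same_orbit_sym => //; apply: lin_equiv_lower; exact: reads_lin_equiv.
Qed.

Lemma at_ter a : at_point (ter (word_edge a)) (upper R a).
Proof.
have [e ra] := all_readable a; rewrite -(reads_word_edge ra).
exists (e, true); first exact: core_endpoint.
apply: same_orbit_sym => //; apply: lin_equiv_upper; exact: reads_lin_equiv.
Qed.

(** The two excluded vertices are the orbits of 0 and 1, the ends of the root interval. *)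
Lemma inner_at_point v : inner v -> exists x, [/\ 0 < x < 1, dyadic x & at_point v x].
Proof.
have er : core_root X = word_edge [::].
  exact: (@reads_word_edge [::] None (same_edge_refl _)).
move=> [v0 v1]; pose p := repr (v : core_vertex X).
have hv : at_point v (point p).
  by exists p; [rewrite reprK|apply: same_orbit_refl].
exists (point p); split=> //.
  have p0 : point p != 0.
    apply/eqP => e; apply: v0; apply: at_point_inj (hv) _.
    by rewrite e er; apply: (at_ini [::]).
  have p1 : point p != 1.
    apply/eqP => e; apply: v1; apply: at_point_inj (hv) _.
    by rewrite e er -(upper_nil R); apply: (at_ter [::]).
  rewrite lt_neqAle eq_sym p0 lt_neqAle p1 /= /point.
  by case: ifP; rewrite ?lower_ge0 ?upper_le1 ?(ltW (upper_gt0 _ _)) ?(ltW (lower_lt1 _ _)).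
by apply/dyadic_grid; exists (size (addr p.1)); rewrite /point; case: ifP => _;
  [apply: grid_upper|apply: grid_lower].
Qed.

Lemma dyadic_image h x : H h -> dyadic x -> 0 <= x <= 1 -> dyadic (h x).
Proof.
have [sub _ _ _] := H_sub.
move=> /sub hH hx /andP[x0]; rewrite le_eqVlt => /orP[/eqP -> |x1].
  by rewrite thompson1 //; apply/dyadic_grid; exists 0%N; apply: grid1.
have [N hN] := thompson_words hH; move/dyadic_grid: hx => [n hn].
have [a sa <-] := word_at (grid_leq (leq_maxr N n) hn) x0 x1.
have [|b hb] := hN a; first by rewrite sa leq_maxl.
by rewrite (lin_lower hb); apply: dyadic_lower.
Qed.

(** * Path classes as orbits of pairs of points *)

Implicit Types (E : edge (core X)) (p q : seq (edge (core X))).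

(* The two endpoints of an edge, up to the diagonal action of [H]. *)
Definition edge_spans E (x y : R) : Prop := exists a, E = word_edge a /\
  exists2 h, H h & h (lower R a) = x /\ h (upper R a) = y.

(** The path is developed in [0,1]: each edge is realized by a translate of its interval, adjacent
    to the previous one. *)
Fixpoint spans p (x y : R) : Prop :=
  if p is E :: p' then exists2 z, edge_spans E x z & spans p' z y else x = y.

Lemma edge_spans_word a x y : edge_spans (word_edge a) x y <->
  exists2 h, H h & h (lower R a) = x /\ h (upper R a) = y.
Proof.
have [_ _ comp _] := H_sub.
split=> [[b [/word_edge_eq[g gH gl]] [h hH [<- <-]]]|]; last by exists a.
exists (h \o g); first exact: comp.
by rewrite /= (lin_lower gl) (lin_upper gl).
Qed.

Lemma edge_spans_lt E x y : edge_spans E x y ->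
  [/\ dyadic x, dyadic y, 0 <= x, x < y & y <= 1].
Proof.
have [sub _ _ _] := H_sub.
have dl a : dyadic (lower R a) by apply: dyadic_lower.
have du a : dyadic (upper R a) by apply: dyadic_upper.
move=> [a [_ [h hH [<- <-]]]].
have l01 : 0 <= lower R a <= 1 by rewrite lower_ge0 ltW // lower_lt1.
have u01 : 0 <= upper R a <= 1 by rewrite upper_le1 ltW // upper_gt0.
have /andP[? ?] := thompson_range (sub _ hH) l01.
have /andP[? ?] := thompson_range (sub _ hH) u01.
split=> //; try exact: dyadic_image.
by rewrite thompson_lt ?lower_lt_upper //; apply: sub.
Qed.

Lemma spans_lt p x y : p <> [::] -> spans p x y ->
  [/\ dyadic x, dyadic y, 0 <= x, x < y & y <= 1].
Proof.
elim: p x => // E [|E' p] IH x _ [z hE hp].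
  by move: hp => /= <-; apply: edge_spans_lt hE.
have [dx dz x0 xz z1] := edge_spans_lt hE.
have [//|_ dy z0 zy y1] := IH z _ hp.
by split=> //; apply: lt_trans zy.
Qed.

Lemma spans_cat p q x y : spans (p ++ q) x y <-> exists2 z, spans p x z & spans q z y.
Proof.
elim: p x => [|E p IH] x /=; first by split=> [|[z ->]] //; exists x.
split=> [[z hE /IH[z' h h']]|[z' [z hE h] h']].
  by exists z' => //; exists z.
by exists z => //; apply/IH; exists z'.
Qed.

(* Both sides of a cell span the same pairs: elements realizing the two halves of an
   interval agree at the midpoint, hence are pasted to one element of the closed group. *)
Lemma spans_cell (c : cell (core X)) x y : spans (top c) x y <-> spans (bot c) x y.
Proof.
have [a [-> ->]] := cell_words c; rewrite /=.
have em : lower R (rcons a true) = upper R (rcons a false).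
  by rewrite upper_rcons lower_rcons /=; ring.
have el : lower R (rcons a false) = lower R a by rewrite lower_rcons mul0r addr0.
have eu : upper R (rcons a true) = upper R a by rewrite upper_rcons /upper /=; field.
split.
  move=> [_ /edge_spans_word[h hH [<- <-]] <-].
  exists (h (upper R (rcons a false))).
    by apply/edge_spans_word; exists h => //; rewrite el.
  exists (h (upper R a)) => //; apply/edge_spans_word; exists h => //.
  by rewrite em eu.
move=> [z /edge_spans_word[h hH [<- hz]]] [_ /edge_spans_word[g gH [gz <-]] <-].
exists (g (upper R (rcons a true))) => //; apply/edge_spans_word.
set m := upper R (rcons a false) in em hz; rewrite em in gz.
have e : h m = g m by rewrite hz gz.
exists (paste h g m).
  apply: paste_closed => //; first by apply: dyadic_upper.
  by rewrite upper_gt0 /= -em lower_lt1.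
rewrite pasteL; last by rewrite -el; apply/ltW/lower_lt_upper.
by rewrite el pasteR ?eu // -eu -em; apply/ltW/lower_lt_upper.
Qed.

Lemma spans_homotopic p q x y : homotopic p q -> spans p x y <-> spans q x y.
Proof.
move=> h; elim: h x y => {p q} [_ _ [p c q]|//|p q _ IH|p q r _ IH _ IH'] x y.
- have hc z : spans (top c ++ q) z y <-> spans (bot c ++ q) z y.
    by rewrite !spans_cat; split=> -[t /spans_cell h h']; exists t.
  by rewrite !(spans_cat p); split=> -[z h /hc h']; exists z.
- by rewrite IH.
- by rewrite IH IH'.
Qed.

Lemma spans_act p x y h : H h -> spans p x y -> spans p (h x) (h y).
Proof.
move=> hH; elim: p x => [x -> //|E p IH] x /= [z [a [-> [g gH [<- <-]]]] /IH hp].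
have [_ _ comp _] := H_sub.
exists (h (g (upper R a))) => //; apply/edge_spans_word.
by exists (h \o g); [apply: comp|].
Qed.

(** For a single edge this is the definition. In general the element for the first edge and the one
    for the rest agree at the intermediate point [z] and are pasted there. *)
Lemma spans_orbit p x y x' y' : p <> [::] -> spans p x y -> spans p x' y' ->
  exists2 h, H h & h x = x' /\ h y = y'.
Proof.
have [sub _ comp hinv] := H_sub.
have one E u v u' v' : edge_spans E u v -> edge_spans E u' v' ->
    exists2 h, H h & h u = u' /\ h v = v'.
  have [a ->] := word_edge_surj E.
  move=> /edge_spans_word[h hH [<- <-]] /edge_spans_word[g gH [<- <-]].
  have [k [kH hk _]] := hinv h hH.
  by exists (g \o k); [apply: comp|rewrite /= !hk].
elim: p x x' => // E [|E' p] IH x x' _ [z hE hp] [z' hE' hp'].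
  by move: hp hp' => /= <- <-; apply: one hE hE'.
have [h1 H1 [e1 f1]] := one _ _ _ _ _ hE hE'.
have [//|h2 H2 [e2 f2]] := IH z z' _ hp hp'.
have [_ dz x0 xz _] := edge_spans_lt hE.
have [//|_ _ _ zy y1] := @spans_lt (E' :: p) z y _ hp.
have e : h1 z = h2 z by rewrite f1 e2.
exists (paste h1 h2 z).
  by apply: paste_closed => //; rewrite (le_lt_trans x0 xz) (lt_le_trans zy y1).
by rewrite pasteL ?(ltW xz) // pasteR ?(ltW zy).
Qed.

Lemma spans_ends u p v x y : p <> [::] -> dpath u p v -> spans p x y ->
  at_point u x /\ at_point v y.
Proof.
have one E z t : edge_spans E z t -> at_point (ini E) z /\ at_point (ter E) t.
  move=> [a [-> [h hH [<- <-]]]]; split.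
    by apply: orbit_at_point (at_ini a) _; exists h.
  by apply: orbit_at_point (at_ter a) _; exists h.
elim: p u x => // E [|E' p] IH u x _ [<- hd] [z hE hp].
  by move: hd hp => /= <- <-; apply: one.
have [hx _] := one _ _ _ hE; split=> //.
by have [] := IH (ter E) z _ hd hp.
Qed.

Lemma path_spans u p v : dpath u p v -> exists x y, spans p x y.
Proof.
elim: p u => [|E [|E' p] IH] u; first by exists 0, 0.
  move=> _; have [a ->] := word_edge_surj E; exists (lower R a), (upper R a) => /=.
  exists (upper R a) => //; apply/edge_spans_word; exists id => //.
  by case: H_sub.
move=> [eu hd]; have [z [y hp]] := IH _ hd.
have [//|hz _] := @spans_ends (ter E) (E' :: p) v z y _ hd hp.
have [a ea] := word_edge_surj E; rewrite ea in hz.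
(* The first edge ends at the vertex where the rest begins, so some [h] translates its interval
   until it abuts on [z]. *)
have [h hH hu] := at_point_orbit (at_ter a) hz.
exists (h (lower R a)), y; exists z => //; rewrite ea; apply/edge_spans_word.
by exists h.
Qed.

Lemma homotopic_cat p p' q q' : homotopic p p' -> homotopic q q' ->
  homotopic (p ++ q) (p' ++ q').
Proof.
move=> hp hq; apply: rst_trans (_ : homotopic (p' ++ q) _).
  elim: hp => {p p'} [_ _ [p c r]|p|p p' _|p p' r _ h _ h'].
  - by apply: rst_step; rewrite -!catA; constructor.
  - exact: rst_refl.
  - exact: rst_sym.
  - exact: rst_trans h h'.
elim: hq => {q q'} [_ _ [q c r]|q|q q' _|q q' r _ h _ h'].
- by apply: rst_step; rewrite !(catA p'); constructor.
- exact: rst_refl.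
- exact: rst_sym.
- exact: rst_trans h h'.
Qed.

Lemma homotopic_subd n a : homotopic [:: word_edge a] (map word_edge (subd n a)).
Proof.
elim: n a => [|n IH] a /=; first exact: rst_refl.
rewrite map_cat; apply: rst_trans (homotopic_cat (IH _) (IH _)) => /=.
have [c [<- eb]] := word_cell a; apply: rst_step; rewrite -eb.
by rewrite -[top c]cats0 -[bot c]cats0; apply: (ElementaryHomotopy [::] c [::]).
Qed.

(** Subdivide each edge until the element realizing it is affine on the pieces. The images of the
    pieces are words naming the same edges, and they are adjacent. *)
Lemma spans_chain p x y : spans p x y ->
  exists2 ws, chain x ws y & homotopic p (map word_edge ws).
Proof.
have [sub _ _ _] := H_sub.
elim: p x => [x ->|E p IH x] /=; first by exists [::] => //; apply: rst_refl.
move=> [z [a [-> [h hH [<- <-]]]] /IH[ws hws hp]].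
have [N hN] := thompson_words (sub _ hH).
have [|bs hb hc] := chain_lin (f := h) _ (chain_subd R N a).
  by move=> b /size_subd sb; apply: hN; rewrite sb leq_addl.
exists (bs ++ ws); first exact: chain_cat hc hws.
rewrite map_cat -cat1s; apply: homotopic_cat hp.
have -> : map word_edge bs = map word_edge (subd N a).
  elim: (subd N a) (bs) hb => [|b bs' IHb] [|b' bs''] //= [hl /IHb ->]; congr cons.
  by apply/word_edge_eq; apply: lin_equiv_sym => //; exists h.
exact: homotopic_subd.
Qed.

Lemma chain_homotopic n (x : R) ws y : chain x ws y -> {in ws, forall a, (size a <= n)%N} ->
  exists ws' : seq (seq bool), [/\ chain x ws' y, {in ws', forall a, size a = n} &
    homotopic (map word_edge ws) (map word_edge ws')].
Proof.
elim: ws x => [|a ws IH] x /=; first by exists [::]; split=> //; apply: rst_refl.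
move=> [<- h] hs; have [|ws' [hc hs' hh]] := IH _ h.
  by move=> b hb; apply: hs; rewrite in_cons hb orbT.
exists (subd (n - size a) a ++ ws'); split.
- exact: chain_cat (chain_subd _ _ _) hc.
- move=> b; rewrite mem_cat => /orP[/size_subd ->|/hs' //].
  by rewrite subnKC // hs // mem_head.
by rewrite map_cat -cat1s; apply: homotopic_cat hh; apply: homotopic_subd.
Qed.

(** Both paths are homotopic to chains filling [x,y]; refined to the maximal word length [n], the
    two chains coincide. *)
Lemma spans_inj p q x y : spans p x y -> spans q x y -> homotopic p q.
Proof.
move=> /spans_chain[ws hw hp] /spans_chain[ws' hw' hq].
pose n := \max_(a <- ws ++ ws') size a.
have le a : a \in ws ++ ws' -> (size a <= n)%N by move=> ha; apply: leq_bigmax_seq.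
have [|us [uc us1 uh]] := @chain_homotopic n _ _ _ hw.
  by move=> a ha; apply: le; rewrite mem_cat ha.
have [|us' [uc' us1' uh']] := @chain_homotopic n _ _ _ hw'.
  by move=> a ha; apply: le; rewrite mem_cat ha orbT.
apply: rst_trans hp _; apply: rst_trans uh _; apply: rst_sym.
apply: rst_trans hq _; apply: rst_trans uh' _.
by rewrite (chain_uniform us1' us1 uc' uc); apply: rst_refl.
Qed.

Lemma chain_path u v x ws y : chain x ws y -> at_point u x -> at_point v y ->
  dpath u (map word_edge ws) v /\ spans (map word_edge ws) x y.
Proof.
elim: ws x u => [|a ws IH] x u /=.
  by move=> <- hu hv; split=> //; apply: at_point_inj hu hv.
move=> [<- hc] hu hv; have [hd hs] := IH _ _ hc (at_ter a) hv.
split; first by split=> //; apply: at_point_inj (at_ini a) hu.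
exists (upper R a) => //; apply/edge_spans_word; exists id => //.
by case: H_sub.
Qed.

Lemma spans_exists u v x y : at_point u x -> at_point v y -> dyadic x -> dyadic y ->
  0 <= x -> x < y -> y <= 1 ->
  exists p, [/\ p <> [::], dpath u p v & spans p x y].
Proof.
move=> hu hv /dyadic_grid[n hn] /dyadic_grid[m hm] x0 xy y1.
have [ws hw] := chain_exists (grid_leq (leq_maxl n m) hn) (grid_leq (leq_maxr n m) hm)
  x0 y1 (ltW xy).
have [hd hs] := chain_path hw hu hv.
exists (map word_edge ws); split=> // e; case: (ws) e hw => //= _ e.
by move: xy; rewrite e ltxx.
Qed.

End CoreWords.

(** * Slopes at the endpoints and dynamics of H *)

Section Slopes.
Variable R : realType.
Implicit Types (f g h : R -> R) (k l : int) (x y z : R).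

(** Exact linearity near the endpoint replaces the limit in [pi_ab]; [pi_ab_slopes] makes the
    link. *)
Definition slope0 f k := exists2 e : R, 0 < e & forall x, 0 <= x <= e -> f x = 2%:R ^ k * x.

Definition slope1 f k :=
  exists2 e : R, 0 < e & forall x, 1 - e <= x <= 1 -> f x = 1 + 2%:R ^ k * (x - 1).

Lemma exp2_gt0 k : 0 < 2%:R ^ k :> R.
Proof. by rewrite exprz_gt0. Qed.

Lemma exp2_inj k l : 2%:R ^ k = 2%:R ^ l :> R -> k = l.
Proof. by apply: ieexprIz; rewrite // pnatr_eq1. Qed.

Lemma exp2D k l : 2%:R ^ (k + l) = 2%:R ^ k * 2%:R ^ l :> R.
Proof. by rewrite expfzDr ?pnatr_eq0. Qed.

Lemma slope0_id : slope0 id 0.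
Proof. by exists 1 => // x _; rewrite expr0z mul1r. Qed.

Lemma slope1_id : slope1 id 0.
Proof. by exists 1 => // x _; rewrite expr0z mul1r addrC subrK. Qed.

Lemma slope0_comp f g k l : slope0 f k -> slope0 g l -> slope0 (f \o g) (k + l).
Proof.
move=> [d d0 hd] [e e0 he]; have l0 := exp2_gt0 l.
exists (Num.min e (d / 2%:R ^ l)); first by rewrite lt_min e0 divr_gt0.
move=> x /andP[x0]; rewrite le_min => /andP[xe xd] /=.
rewrite he ?x0 // hd ?exp2D ?mulrA // mulr_ge0 ?(ltW l0) //=.
by rewrite mulrC -ler_pdivlMr.
Qed.

Lemma slope1_comp f g k l : slope1 f k -> slope1 g l -> slope1 (f \o g) (k + l).
Proof.
move=> [d d0 hd] [e e0 he]; have l0 := exp2_gt0 l.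
exists (Num.min e (d / 2%:R ^ l)); first by rewrite lt_min e0 divr_gt0.
move=> x /andP[xe x1].
have {}xe : 1 - x <= Num.min e (d / 2%:R ^ l) by lra.
move: xe; rewrite le_min => /andP[xe xd] /=.
rewrite ler_pdivlMr // in xd.
have p0 : 0 <= 2%:R ^ l * (1 - x) by rewrite mulr_ge0 ?(ltW l0) // subr_ge0.
rewrite he; last by apply/andP; split; lra.
rewrite hd; first by rewrite exp2D; ring.
by apply/andP; split; lra.
Qed.

Lemma slope0_paste f g z k : 0 < z -> slope0 f k -> slope0 (paste f g z) k.
Proof.
move=> z0 [e e0 he]; exists (Num.min e z); first by rewrite lt_min e0.
by move=> x; rewrite le_min => /and3P[x1 x2 x3]; rewrite pasteL // he ?x1.
Qed.

Lemma slope1_paste f g z k : f z = g z -> z < 1 -> slope1 g k -> slope1 (paste f g z) k.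
Proof.
move=> fz z1 [e e0 he]; exists (Num.min e (1 - z)); first by rewrite lt_min e0 subr_gt0.
move=> x /andP[x1 x2].
have : 1 - x <= Num.min e (1 - z) by lra.
rewrite le_min => /andP[h1 h2]; rewrite (pasteR fz); last lra.
by rewrite he // x2 andbT; lra.
Qed.

Lemma slope0_exists f : thompsonF f -> exists k, slope0 f k.
Proof.
move=> hf; have [N hN] := thompson_words hf.
have [a sa la] := word_at (grid0 R N) (lexx 0) ltr01.
have [|b hb] := hN a; first by rewrite sa.
have lb : lower R b = 0 by rewrite -(lin_lower hb) la thompson0.
exists ((size a)%:Z - (size b)%:Z), (upper R a); first exact: upper_gt0.
by move=> x hx; rewrite hb ?la // lb ratio_exp add0r subr0.
Qed.

Lemma slope1_exists f : thompsonF f -> exists k, slope1 f k.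
Proof.
move=> hf; have [N hN] := thompson_words hf.
have [a sa ua] := word_ending (grid1 R N) ltr01 (lexx 1).
have [|b hb] := hN a; first by rewrite sa.
have ub : upper R b = 1 by rewrite -(lin_upper hb) ua thompson1.
exists ((size a)%:Z - (size b)%:Z), (width R a); first exact: width_gt0.
move=> x hx; rewrite hb.
  rewrite -ratio_exp; move: ua ub; rewrite /upper => ua ub.
  have -> : lower R b = 1 - width R b by lra.
  have -> : lower R a = 1 - width R a by lra.
  by field; apply: width_neq0.
by move: hx; rewrite -{1}ua /upper addrK -/(upper R a) ua.
Qed.

Lemma pi_ab_slopes f k l : thompsonF f -> slope0 f k -> slope1 f l -> pi_ab f (k, l).
Proof.
move=> hf [d d0 hd] [e e0 he]; split; apply: cvg_near_cst => /=.
  near=> x.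
  have x0 : 0 < x by near: x; exact: nbhs_right_gt.
  have xd : x <= d by near: x; exact: nbhs_right_le.
  by rewrite thompson0 // !subr0 hd ?xd ?ltW // mulfK // gt_eqF.
near=> x.
have x1 : x < 1 by near: x; exact: nbhs_left_lt.
have xe : 1 - e <= x by near: x; apply: nbhs_left_ge; lra.
rewrite thompson1 // he ?xe ?ltW // addrAC subrr add0r mulfK //.
by rewrite subr_eq0 lt_eqF.
Unshelve. all: by end_near.
Qed.

Lemma pi_ab_uniq f a b : pi_ab f a -> pi_ab f b -> a = b.
Proof.
case: a b => [a1 a2] [b1 b2] [/= h1 h2] [h1' h2'].
by congr (_, _); apply: exp2_inj; [apply: cvg_unique h1 h1'|apply: cvg_unique h2 h2'].
Qed.

End Slopes.

(** * The group of slopes, and elements supported near the left end *)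

Section Dynamics.
Variables (R : realType) (H : set (R -> R)).
Hypotheses (H_sub : subgroupF H) (H_closed : closedF H) (H_minimal : minimal_action H).
Implicit Types (f g h : R -> R) (k l : int) (x y z : R).

Let A := pi_ab_image H.

Lemma pi_ab_imageP k l : A (k, l) <-> exists h, [/\ H h, slope0 h k & slope1 h l].
Proof.
have [sub _ _ _] := H_sub.
split=> [[h hH hp]|[h [hH h0 h1]]]; last first.
  by exists h => //; apply: pi_ab_slopes => //; apply: sub.
have [[k' hk] [l' hl]] := (slope0_exists (sub _ hH), slope1_exists (sub _ hH)).
have [-> ->] := pi_ab_uniq hp (pi_ab_slopes (sub _ hH) hk hl).
by exists h.
Qed.

Lemma slopes_inv h g k l : H h -> H g -> cancel g h ->
  slope0 h k -> slope1 h l -> slope0 g (- k) /\ slope1 g (- l).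
Proof.
have [sub _ _ _] := H_sub.
move=> hH gH hK hk hl.
have [[k' gk] [l' gl]] := (slope0_exists (sub _ gH), slope1_exists (sub _ gH)).
have e : h \o g = id by apply/funext => x /=; rewrite hK.
have h0 := slope0_comp hk gk; have h1 := slope1_comp hl gl; rewrite e in h0 h1.
have [e0 e1] := pi_ab_uniq (pi_ab_slopes (sub _ (subgroupF_id H_sub)) h0 h1)
  (pi_ab_slopes (sub _ (subgroupF_id H_sub)) (slope0_id R) (slope1_id R)).
have -> : - k = k' by lia.
by have -> : - l = l' by lia.
Qed.

Lemma image0 : A (0, 0).
Proof.
by apply/pi_ab_imageP; exists id; split; [case: H_sub|exact: slope0_id|exact: slope1_id].
Qed.

Lemma imageD a b : A a -> A b -> A (a + b).
Proof.
case: a b => [a1 a2] [b1 b2] /pi_ab_imageP[f [fH f0 f1]] /pi_ab_imageP[g [gH g0 g1]].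
apply/pi_ab_imageP; exists (f \o g); split.
- by have [_ _ comp _] := H_sub; apply: comp.
- exact: slope0_comp.
- exact: slope1_comp.
Qed.

Lemma imageN a : A a -> A (- a).
Proof.
case: a => [a1 a2] /pi_ab_imageP[f [fH f0 f1]].
have [_ _ _ /(_ _ fH)[g [gH fK gK]]] := H_sub.
have [g0 g1] := slopes_inv fH gH gK f0 f1.
by apply/pi_ab_imageP; exists g.
Qed.

(** An element of slope 1 at 1 is trivial on some [z,1]. Conjugation by an element moving [z] to the
    left of [y] makes it trivial from [y] on and preserves the slope at 0. *)
Lemma local_slope k y : A (k, 0) -> 0 < y < 1 ->
  exists c, [/\ H c, slope0 c k & forall x, y <= x -> c x = x].
Proof.
have [sub _ comp hinv] := H_sub.
move=> /pi_ab_imageP[h [hH h0 [e e0 h1]]] /andP[y0 y1].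
(* The minimum with 1/2 keeps [z] positive when [e] is large. *)
pose z := 1 - Num.min e 2%:R^-1.
have hz : [/\ 1 - e <= z, 0 < z & z < 1].
  rewrite /z; split; [|have : Num.min e 2%:R^-1 <= 2%:R^-1 :> R|].
  - by rewrite lerD2l lerN2 ge_min lexx.
  - by rewrite ge_min lexx orbT.
  - by lra.
  by rewrite ltrBlDr ltrDl lt_min e0 invr_gt0 ltr0n.
have [ze z0 z1] := hz.
have [||||g gH /andP[g0 gy]] := dense_orbit H_minimal (w := z) (x := 0) (y := y).
- by rewrite z0.
- by [].
- by [].
- exact: ltW.
have [g' [gH' gK gK']] := hinv g gH.
exists (g \o (h \o g')); split.
- by apply: (subgroupF_comp H_sub) => //; apply: (subgroupF_comp H_sub).
- have [s gs] := slope0_exists (sub _ gH); have [t gt] := slope1_exists (sub _ gH).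
  have [gs' _] := slopes_inv gH gH' gK' gs gt.
  by have := slope0_comp gs (slope0_comp h0 gs'); rewrite addrC subrK.
move=> x yx /=; have [x1|x1] := leP x 1; last first.
  have out f : thompsonF f -> f x = x.
    by move=> [out _ _ _ _]; apply: out; rewrite in_itv /= negb_and -!ltNge x1 orbT.
  by rewrite !out //; apply: sub.
rewrite h1 ?gK' //.
  by rewrite expr0z mul1r addrC subrK gK'.
rewrite (le_trans ze) /=.
  by rewrite -(thompson1 (sub _ gH')) thompson_le ?x1 //; apply: sub.
rewrite -(gK z) thompson_le; last exact: sub.
exact: le_trans (ltW gy) yx.
Qed.

Variable k0 : int.
Hypotheses (k0_gt0 : 0 < k0) (Ak0 : A (k0, 0)).

Lemma iter_H f n : H f -> H (iter n f).
Proof.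
have [_ hid comp _] := H_sub.
by move=> fH; elim: n => [|n IH] //=; apply: (comp f (iter n f)).
Qed.

(** Otherwise the orbit of [a] has a supremum in (0,b). As [f] moves it to the right, its preimage
    lies below it; some iterate exceeds the preimage, and the next one exceeds the supremum. *)
Lemma iter_sup f b a p : H f -> (forall t, 0 < t -> t < b -> t < f t) -> f b = b ->
  0 < a -> a < b -> p < b -> exists n, p < iter n f a.
Proof.
move=> fH fgt fb a0 ab pb; apply: contrapT => /forallNP hn.
have [sub _ _ hinv] := H_sub.
have lt_b n : iter n f a < b.
  by elim: n => [|n IH] //=; rewrite -[ltRHS]fb thompson_lt //; apply: sub.
have ge_a n : a <= iter n f a.
  elim: n => [|n IH] //=; apply: le_trans IH _; apply/ltW/fgt => //.
  by elim: n => [|n IH] //=; apply: (lt_trans IH); apply: fgt.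
pose S := [set iter n f a | n in [set: nat]].
have hS : has_sup S.
  split; first by exists a, 0%N.
  by exists p => _ [n _ <-]; rewrite leNgt; apply/negP/hn.
have Sle n : iter n f a <= sup S by apply: ub_le_sup; [case: hS|exists n].
have sp : sup S <= p.
  by apply: ge_sup; [case: hS|move=> _ [n _ <-]; rewrite leNgt; apply/negP/hn].
have s0 : 0 < sup S by apply: lt_le_trans a0 (Sle 0%N).
have [g [gH fK gK]] := hinv f fH.
have gs : g (sup S) < sup S.
  rewrite -[ltRHS]fK thompson_lt //; first exact: sub.
  by apply: fgt => //; apply: le_lt_trans sp pb.
have [_ [n _ <-] hlt] := sup_gt hS.1 gs.
have : sup S < f (iter n f a) by rewrite -[ltLHS]gK thompson_lt //; apply: sub.
by rewrite ltNge (Sle n.+1).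
Qed.

(** Take [f] with slope 2^k0 > 1 at 0 and trivial from 1/2 on. Then [b] is the infimum of the
    positive points not moved to the right; it is positive since [f] expands near 0. *)
Lemma expanding_element : exists f b z, [/\ H f, 0 < b, b <= z & z < 1] /\
  [/\ f b = b, forall t, 0 < t -> t < b -> t < f t & forall x, z <= x -> f x = x].
Proof.
have [sub _ _ _] := H_sub.
have [|f [fH [e e0 fe] fz]] := local_slope Ak0 (y := 2%:R^-1); first by apply/andP; split; lra.
pose S := [set t : R | 0 < t /\ f t <= t].
have Sz : S 2%:R^-1 by split; [lra|rewrite fz].
have lbS t : S t -> e <= t.
  move=> [t0 ft]; rewrite leNgt; apply/negP => te; move: ft.
  rewrite fe ?(ltW t0) ?(ltW te) // leNgt ltr_pMl // => /negP; apply.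
  by rewrite -(expr0z 2%:R) ltr_eXz2l ?ltr1n.
have hS : has_inf S by split; [exists 2%:R^-1|exists e => t; apply: lbS].
have eb : e <= inf S by apply: lb_le_inf; [case: hS|move=> t; apply: lbS].
have b0 : 0 < inf S by apply: lt_le_trans eb.
have bz : inf S <= 2%:R^-1 by apply: ge_inf; [case: hS|].
have fgt t : 0 < t -> t < inf S -> t < f t.
  move=> t0 tb; rewrite ltNge; apply/negP => ft; move: tb.
  by rewrite ltNge; move/negP; apply; apply: ge_inf; [case: hS|].
exists f, (inf S), 2%:R^-1; split; split=> //; first lra.
apply/eqP; rewrite eq_le; apply/andP; split.
  rewrite leNgt; apply/negP => fb.
  have [t [t0 ft] tb] := inf_lt (ex_intro _ _ Sz) fb.
  have bt : inf S <= t by apply: ge_inf; [case: hS|].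
  by move: ft; rewrite leNgt; move/negP; apply; apply: lt_le_trans tb _; rewrite thompson_le //; apply: sub.
rewrite leNgt; apply/negP => fb.
(* If f b < b, this positive point below [b] satisfies f b <= t < f t, against monotonicity; b/2
   only ensures t > 0. *)
pose t := Num.max (f (inf S)) (inf S / 2%:R).
have tb : t < inf S by rewrite gt_max fb; lra.
have t0 : 0 < t by rewrite lt_max orbC divr_gt0.
have : f t < f (inf S) by rewrite thompson_lt //; apply: sub.
rewrite ltNge; move/negP; apply; apply: le_trans (ltW (fgt _ t0 tb)).
by rewrite le_max lexx.
Qed.

(* For [f] expanding on (0,b) and trivial on [z,1], some [g] in [H] carries the pair (b,z) into
   any prescribed left neighbourhood of [y]: move [z] below [b], push it back towards [b] by
   powers of [f], and carry [b] close to [y] by minimality.  Then iterate the conjugate of [f]. *)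
Lemma push_right a p y : 0 < a -> a < y -> p < y -> y <= 1 ->
  exists c, [/\ H c, forall x, y <= x -> c x = x & p < c a].
Proof.
have [sub _ comp hinv] := H_sub.
have [f [b [z [[fH b0 bz z1] [fb fgt fz]]]]] := expanding_element.
(* The conjugator must send [b] beyond [m], so that [a] and [p] are both pulled back below [b]. *)
move=> a0 ay py y1; pose m := Num.max p a.
have my : m < y by rewrite gt_max py.
have m0 : 0 < m by rewrite lt_max a0 orbT.
have [||||k kH /andP[mk ky]] := dense_orbit H_minimal (w := b) (x := m) (y := y).
- by rewrite b0 (le_lt_trans bz).
- exact: ltW.
- by [].
- by [].
have [||||g1 g1H /andP[g10 g1b]] := dense_orbit H_minimal (w := z) (x := 0) (y := b).
- by rewrite (lt_le_trans b0 bz) z1.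
- by [].
- by [].
- exact: le_trans bz (ltW z1).
have [k' [kH' kK kK']] := hinv k kH.
have g1b0 : 0 < g1 b by rewrite -(thompson0 (sub _ g1H)) thompson_lt //; apply: sub.
have g1bb : g1 b < b by apply: le_lt_trans g1b; rewrite thompson_le //; apply: sub.
have km : k' m < b by rewrite -[ltRHS]kK thompson_lt //; apply: sub.
have [n hn] := iter_sup fH fgt fb g1b0 g1bb km.
have fnH := iter_H n fH.
pose g := k \o (iter n f \o g1).
have gH : H g by apply: (subgroupF_comp H_sub) => //; apply: (subgroupF_comp H_sub).
have gb : m < g b by rewrite -[ltLHS]kK' thompson_lt //; apply: sub.
have gz : g z < y.
  apply: lt_trans ky; rewrite /g /= thompson_lt //; first exact: sub.
  have -> : b = iter n f b by elim: n {hn fnH g gH gb} => //= n <-.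
  by rewrite thompson_lt //; apply: sub.
have [g' [gH' gK gK']] := hinv g gH.
have ga0 : 0 < g' a by rewrite -(thompson0 (sub _ gH')) thompson_lt //; apply: sub.
have gab : g' a < b.
  rewrite -[ltRHS]gK thompson_lt //; first exact: sub.
  by apply: le_lt_trans gb; rewrite le_max lexx orbT.
have gpb : g' p < b.
  rewrite -[ltRHS]gK thompson_lt //; first exact: sub.
  by apply: le_lt_trans gb; rewrite le_max lexx.
have [N hN] := iter_sup fH fgt fb ga0 gab gpb.
have fNH := iter_H N fH.
exists (g \o (iter N f \o g')); split.
- by apply: (subgroupF_comp H_sub) => //; apply: (subgroupF_comp H_sub).
- move=> x yx /=.
  have zx : z <= g' x.
    rewrite -(gK z) thompson_le; last exact: sub.
    exact: le_trans (ltW gz) yx.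
  have -> : iter N f (g' x) = g' x by elim: N {hN fNH} => //= N ->; apply: fz.
  exact: gK'.
by rewrite -[ltLHS]gK' /= thompson_lt //; apply: sub.
Qed.

Lemma transport_fixing h x y k : H h -> slope0 h k -> A (k, 0) -> 0 < x -> x < y ->
  x < h y -> y < 1 -> exists c, [/\ H c, c x = x & c y = h y].
Proof.
have [sub _ comp hinv] := H_sub.
move=> hH hk Ak x0 xy xhy y1.
have ANk : A (- k, 0).
  by have := imageN Ak; congr A; rewrite -[LHS]/(- k, - 0) oppr0.
(* The correction [c0] cancels the slope of [h] at 0 and is trivial from [y] on, so the value at [y]
   is kept. *)
have [|c0 [c0H c0k c0id]] := local_slope ANk (y := y).
  by rewrite y1 (lt_trans x0 xy).
pose h' := h \o c0; have h'H : H h' by apply: comp.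
have h'y : h' y = h y by rewrite /h' /= c0id.
have [e e0 he] : slope0 h' 0 by have := slope0_comp hk c0k; rewrite subrr.
pose y' := Num.min y (h y); pose a := Num.min e (x / 2%:R).
have xy' : x < y' by rewrite lt_min xy.
have a0 : 0 < a by rewrite lt_min e0 divr_gt0.
have ay : a < y' by apply: le_lt_trans xy'; rewrite ge_min; apply/orP; right; lra.
have [|c [cH cid ca]] := push_right a0 ay xy'.
  by rewrite ge_min (ltW y1).
have [c' [cH' cK cK']] := hinv c cH.
(* The inverse of [c] brings [x] into the region near 0 where [h'] is trivial, so the conjugate
   fixes [x]; [c] itself fixes [y] and [h y]. *)
exists (c \o (h' \o c')); split.
- by apply: (subgroupF_comp H_sub) => //; apply: (subgroupF_comp H_sub).
- rewrite /= he ?expr0z ?mul1r ?cK' //.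
  rewrite -(thompson0 (sub _ cH')) thompson_le ?(ltW x0) /=; last exact: sub.
  apply: (@le_trans _ _ a); last by rewrite ge_min lexx.
  by rewrite -[leRHS]cK thompson_le ?(ltW ca) //; apply: sub.
have cy : c' y = y by rewrite -{1}(cid y) // ge_min lexx.
by rewrite /= cy h'y cid // ge_min lexx orbT.
Qed.

End Dynamics.

(** * Counting *)

Section Cosets.
Variable A : set (int * int).
Hypotheses (A0 : A 0) (AD : forall a b, A a -> A b -> A (a + b))
  (AN : forall a, A a -> A (- a)).

Lemma coset_eq b c : [set b + a | a in A] = [set c + a | a in A] <-> A (b - c).
Proof.
split=> [e|h].
  have : [set c + a | a in A] b by rewrite -e; exists 0 => //; rewrite addr0.
  by move=> [a ha <-]; rewrite addrAC subrr add0r.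
apply/seteqP; split=> _ [a ha <-].
  by exists (b - c + a); [apply: AD|rewrite addrCA addrA subrK].
exists (- (b - c) + a); first by apply: AD => //; apply: AN.
by rewrite opprB addrCA addrA subrK.
Qed.

Lemma subgroupMz a (n : int) : A a -> A (a *~ n).
Proof.
move=> ha; have hn (m : nat) : A (a *+ m).
  by elim: m => [|m IH]; [exact: A0|rewrite mulrS; apply: AD].
by case: n => m; [exact: hn|rewrite NegzE mulrNz; apply/AN/hn].
Qed.

Lemma pairMz (a : int * int) (n : int) : a *~ n = (a.1 * n, a.2 * n).
Proof.
have hn (m : nat) : a *+ m = (a.1 * m%:Z, a.2 * m%:Z).
  elim: m => [|m IH]; first by rewrite !mulr0.
  by rewrite mulrS IH; congr (_, _); rewrite /= -addn1 PoszD; ring.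
case: n => m; first by rewrite -pmulrn hn.
by rewrite NegzE mulrNz -pmulrn hn; congr (_, _); rewrite /= mulrN.
Qed.

(** Up to sign, [D] is the determinant of two independent elements of [A]; Cramer's rule puts its
    multiples of the axis vectors into [A]. *)
Lemma rank2_axes : has_rank A 2 -> exists D : int, [/\ 0 < D, A (D, 0) & A (0, D)].
Proof.
move=> [[a ha hfree] _]; pose a1 := a ord0; pose a2 := a (lift ord0 ord0).
have indep (s t : int) : a1 *~ s + a2 *~ t = 0 -> s = 0 /\ t = 0.
  move=> e; pose c (i : 'I_2) : int := if i == ord0 then s else t.
  have : forall i, c i = 0 by apply: hfree; rewrite big_ord_recl big_ord1.
  by move=> hc; have := hc ord0; have := hc (lift ord0 ord0).
pose D : int := a1.1 * a2.2 - a1.2 * a2.1.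
have D0 : D != 0.
  apply/eqP => e.
  (* A vanishing determinant makes the adjugate entries coefficients of relations; then all four
     entries vanish, and 1, 1 is a nontrivial relation. *)
  have [|e22 e12] := indep a2.2 (- a1.2).
    rewrite !pairMz; congr (_, _) => /=; last by ring.
    by rewrite mulrN [_ * a1.2]mulrC.
  have [|e21 e11] := indep a2.1 (- a1.1).
    rewrite !pairMz; congr (_, _) => /=; first by ring.
    by move: e; rewrite /D => e; lia.
  have [|//] := indep 1 1.
  by rewrite !pairMz; congr (_, _) => /=; lia.
have AD0 : A (D, 0).
  have -> : (D, 0) = a1 *~ a2.2 + a2 *~ (- a1.2).
    by rewrite !pairMz /D; congr (_, _) => /=; ring.
  by apply: AD; apply: subgroupMz; apply: ha.
have A0D : A (0, D).
  have -> : (0, D) = a1 *~ (- a2.1) + a2 *~ a1.1.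
    by rewrite !pairMz /D; congr (_, _) => /=; ring.
  by apply: AD; apply: subgroupMz; apply: ha.
have [Dp|Dn] := ltP 0 D; first by exists D.
exists (- D); split; first by rewrite oppr_gt0 lt_neqAle D0.
  by have := AN AD0; congr A; rewrite -[LHS]/(- D, - 0) oppr0.
by have := AN A0D; congr A; rewrite -[LHS]/(- 0, - D) oppr0.
Qed.

(** Both coordinates may be reduced modulo [D], which leaves finitely many representatives. *)
Lemma finite_cosets B : has_rank A 2 -> finite_set (cosets B A).
Proof.
move=> /rank2_axes[D [D0 AD0 A0D]].
pose F (p : nat * nat) := [set (p.1%:Z, p.2%:Z) + a | a in A].
apply: (@sub_finite_set _ _ (F @` (`I_`|D| `*` `I_`|D|))).
  move=> _ [b _ <-].
  exists (`|(b.1 %% D)%Z|%N, `|(b.2 %% D)%Z|%N).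
    by rewrite /=; split; have := modz_ge0 b.1 (lt0r_neq0 D0);
      have := ltz_pmod b.1 D0; have := modz_ge0 b.2 (lt0r_neq0 D0);
      have := ltz_pmod b.2 D0; lia.
  apply/coset_eq => /=.
  have -> : (`|(b.1 %% D)%Z|%N%:Z, `|(b.2 %% D)%Z|%N%:Z) - b =
      (D, 0) *~ (- (b.1 %/ D)%Z) + (0, D) *~ (- (b.2 %/ D)%Z).
    rewrite !pairMz !gez0_abs ?modz_ge0 ?lt0r_neq0 //.
    have e1 := divz_eq b.1 D; have e2 := divz_eq b.2 D.
    congr (_, _) => /=.
      by rewrite {2}e1; ring.
    by rewrite {2}e2; ring.
  by apply: AD; apply: subgroupMz.
by apply: finite_image; apply: finite_setX; apply: finite_II.
Qed.

End Cosets.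

(** * The bijection between path classes and cosets *)

Section Counting.
Variables (R : realType) (H X : set (R -> R)) (dL dR : int).
Hypotheses (H_sub : subgroupF H) (H_closed : closedF H) (H_minimal : minimal_action H).
Hypothesis A_rank : has_rank (pi_ab_image H) 2.
Hypothesis dL_gen : [set a.1 | a in pi_ab_image H] = multiples dL.
Hypothesis dR_gen : [set a.2 | a in pi_ab_image H] = multiples dR.
Hypothesis X_gen : generates X H.

Let A := pi_ab_image H.
Let A0 : A 0 := image0 H_sub.
Let AD := @imageD _ _ H_sub.
Let AN := @imageN _ _ H_sub.
Let spansH := spans H_sub X_gen H_minimal.

Variables (u v : vertex (core X)) (x0 y0 : R).
Hypotheses (x0_01 : 0 < x0 < 1) (y0_01 : 0 < y0 < 1).
Hypotheses (x0_dyadic : dyadic x0) (y0_dyadic : dyadic y0).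
Hypotheses (x0_u : at_point H u x0) (y0_v : at_point H v y0).

(* A path from [u] to [v], translated so as to start at [x0], ends at some [h y0]; its class is
   recorded by the slope exponent of [h] at 0. *)
Definition path_slope (p : seq (edge (core X))) (k : int) : Prop :=
  exists2 h, H h & slope0 h k /\ spansH p x0 (h y0).

Lemma path_slope_exists p : p <> [::] -> dpath u p v -> exists k, path_slope p k.
Proof.
have [sub _ _ _] := H_sub.
move=> p0 hd; have [x [y hs]] := path_spans H_sub H_closed X_gen H_minimal hd.
have [hx hy] := spans_ends H_closed p0 hd hs.
have [g gH gx] := at_point_orbit H_sub H_closed X_gen hx x0_u.
have gs := spans_act H_closed gH hs; rewrite gx in gs.
have [_ hgy] := spans_ends H_closed p0 hd gs.
have [h hH hy0] := at_point_orbit H_sub H_closed X_gen y0_v hgy.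
have [k hk] := slope0_exists (sub _ hH).
by exists k, h => //; rewrite hy0.
Qed.

Lemma path_slope_image p k : path_slope p k -> exists l, A (k, l).
Proof.
have [sub _ _ _] := H_sub.
move=> [h hH [hk _]]; have [l hl] := slope1_exists (sub _ hH).
by exists l; apply/pi_ab_imageP => //; exists h.
Qed.

(** The point [h y0] may lie to the left of [x0]. Pushing it beyond [x0] by an element [c] trivial
    near 1 changes the slope exponent only by some k' with (k',0) in [A]. *)
Lemma image_path_slope k l : A (k, l) ->
  exists p k', [/\ p <> [::], dpath u p v, path_slope p k' & A (k' - k, 0)].
Proof.
have [sub _ comp _] := H_sub.
have [D [D0 AD0 _]] := rank2_axes A0 AD AN A_rank.
move=> /(pi_ab_imageP H_sub)[h [hH hk hl]].
have /andP[x00 x01] := x0_01; have /andP[y00 y01] := y0_01.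
have hy0 : 0 < h y0 by rewrite -(thompson0 (sub _ hH)) thompson_lt //; apply: sub.
have hy1 : h y0 < 1 by rewrite -[ltRHS](thompson1 (sub _ hH)) thompson_lt //; apply: sub.
pose y := (Num.max x0 (h y0) + 1) / 2%:R.
have my : Num.max x0 (h y0) < 1 by rewrite gt_max x01.
have m0 : x0 <= Num.max x0 (h y0) by rewrite le_max lexx.
have xy : x0 < y by rewrite /y; lra.
have m1 : h y0 <= Num.max x0 (h y0) by rewrite le_max lexx orbT.
have hyy : h y0 < y by rewrite /y; lra.
have y1 : y < 1 by rewrite /y; lra.
have [c [cH cid cx]] := push_right H_sub H_minimal D0 AD0 hy0 hyy xy (ltW y1).
have [k' ck] := slope0_exists (sub _ cH).
have cl : slope1 c 0.
  exists (1 - y); first by rewrite subr_gt0.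
  by move=> t /andP[t0 _]; rewrite cid ?expr0z; [ring|lra].
have chH : H (c \o h) by apply: comp.
have dc : dyadic (c (h y0)).
  by apply: (dyadic_image H_sub chH y0_dyadic); rewrite !ltW.
have c1 : c (h y0) < 1 by rewrite -[ltRHS](thompson1 (sub _ cH)) thompson_lt //; apply: sub.
have hv : at_point H v (c (h y0)).
  by apply: (orbit_at_point H_sub) y0_v _; exists (c \o h).
have [p [p0 pd ps]] := spans_exists H_sub H_closed X_gen H_minimal x0_u hv x0_dyadic dc
  (ltW x00) cx (ltW c1).
exists p, (k' + k); split=> //.
  by exists (c \o h) => //; split=> //; apply: slope0_comp.
by rewrite addrK; apply/pi_ab_imageP => //; exists c.
Qed.

Lemma homotopic_slopes p q k l : p <> [::] -> path_slope p k -> path_slope q l ->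
  homotopic p q -> A (k - l, 0).
Proof.
have [sub hid comp hinv] := H_sub.
have /andP[x00 x01] := x0_01; have /andP[y00 y01] := y0_01.
move=> p0 [h hH [hk hp]] [g gH [gl gq]] hpq.
move/(spans_homotopic H_sub H_closed X_gen H_minimal _ _ hpq): gq => gp.
have [_ _ _ xy _] := spans_lt p0 hp.
have [r rH [rx ry]] := spans_orbit H_closed p0 hp gp.
(* [r] fixes [x0] and takes [h y0] to [g y0]; replacing it by the identity on the left of [x0]
   removes its slope at 0. *)
have r'H : H (paste id r x0) by apply: paste_closed.
have r'y : paste id r x0 (h y0) = g y0 by rewrite pasteR // ltW.
have [g' [gH' gK gK']] := hinv g gH.
have [m gm] := slope1_exists (sub _ gH).
have [g'l _] := slopes_inv H_sub gH gH' gK' gl gm.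
have sH : H (g' \o (paste id r x0 \o h)) by apply: (comp) => //; apply: comp.
set s := _ \o _ in sH.
have sy : s y0 = y0 by rewrite /s /= r'y gK.
have sk : slope0 s (k - l).
  have := slope0_comp g'l (slope0_comp (slope0_paste r x00 (slope0_id R)) hk).
  by rewrite add0r addrC.
(* Since [s] fixes [y0], the identity can be pasted on the right, which makes the slope at 1
   trivial. *)
apply/pi_ab_imageP => //; exists (paste s id y0); split.
- exact: paste_closed.
- exact: slope0_paste.
- by apply: slope1_paste => //; apply: slope1_id.
Qed.

(** The element g h^-1 takes [h y0] to [g y0] with slope exponent l - k; [transport_fixing] replaces
    it by one that also fixes [x0], so both paths span one pair. *)
Lemma slopes_homotopic p q k l : p <> [::] -> q <> [::] ->
  path_slope p k -> path_slope q l -> A (k - l, 0) -> homotopic p q.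
Proof.
have [sub hid comp hinv] := H_sub.
have [D [D0 AD0 _]] := rank2_axes A0 AD AN A_rank.
have /andP[x00 x01] := x0_01; have /andP[y00 y01] := y0_01.
move=> p0 q0 [h hH [hk hp]] [g gH [gl gq]] Akl.
have [_ _ _ xhy _] := spans_lt p0 hp; have [_ _ _ xgy _] := spans_lt q0 gq.
have [h' [hH' hK hK']] := hinv h hH.
have [m hm] := slope1_exists (sub _ hH).
have [h'k _] := slopes_inv H_sub hH hH' hK' hk hm.
have rH : H (g \o h') by apply: comp.
have Alk : A (l - k, 0).
  by have := AN Akl; congr A; rewrite -[LHS]/(- (k - l), - 0) oppr0 opprB.
have hy1 : h y0 < 1 by rewrite -[ltRHS](thompson1 (sub _ hH)) thompson_lt //; apply: sub.
have ry : (g \o h') (h y0) = g y0 by rewrite /= hK.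
have [|c [cH cx cy]] := transport_fixing H_sub H_minimal D0 AD0 rH
  (slope0_comp gl h'k) Alk x00 xhy _ hy1; first by rewrite ry.
apply: (spans_inj H_closed) gq.
by have := spans_act H_closed cH hp; rewrite cx cy ry.
Qed.

(** Collecting all representatives and slopes avoids a choice; [class_cosetE] shows that a single
    coset results. *)
Definition class_coset (C : set (seq (edge (core X)))) : set (int * int) :=
  [set b | exists p k, [/\ C p, path_slope p k & A (b - (k, 0))]].

Lemma class_cosetE p k : p <> [::] -> path_slope p k ->
  class_coset [set q | homotopic p q] = [set (k, 0) + a | a in A].
Proof.
move=> p0 pk; apply/seteqP; split=> b.
  move=> [q [l [hpq ql hb]]].
  exists (b - (k, 0)); last by rewrite addrC subrK.
  have -> : b - (k, 0) = (b - (l, 0)) - (k - l, 0).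
    by congr (_, _) => /=; ring.
  by apply: AD => //; apply: AN; apply: homotopic_slopes pk ql hpq.
move=> [a ha <-]; exists p, k; split=> //; first exact: rst_refl.
by rewrite addrC addKr.
Qed.

Lemma class_coset_bij :
  set_bij (path_classes u v) (cosets (multiples dL `*` multiples dR) A) class_coset.
Proof.
split.
- move=> _ [p [p0 pd] <-]; have [k pk] := path_slope_exists p0 pd.
  rewrite (class_cosetE p0 pk); exists (k, 0) => //; split=> /=.
    have [l Akl] := path_slope_image pk.
    by rewrite -dL_gen; exists (k, l).
  by exists 0 => //; rewrite mulr0.
- move=> C C' /set_mem[p [p0 pd] <-] /set_mem[q [q0 qd] <-].
  have [[k pk] [l ql]] := (path_slope_exists p0 pd, path_slope_exists q0 qd).
  rewrite (class_cosetE p0 pk) (class_cosetE q0 ql).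
  move=> /(coset_eq A0 AD AN) Akl.
  have hpq : homotopic p q by apply: slopes_homotopic p0 q0 pk ql _.
  apply/seteqP; split=> r /= hr; last exact: rst_trans hpq hr.
  by apply: rst_trans hr; apply: rst_sym.
move=> _ [[b1 b2] [/= hb1 hb2] <-].
(* Surjectivity: subtracting an element of [A] with second coordinate [b2] leaves a representative
   (k,0), and [k] is itself a first coordinate in [A]. *)
have [a Aa ea] : [set a.2 | a in A] b2 by rewrite dR_gen.
have [i _ ei] : multiples dL a.1 by rewrite -dL_gen; exists a.
have [j _ ej] := hb1.
have [[k l] Akl ek] : [set a.1 | a in A] (b1 - a.1).
  by rewrite dL_gen; exists (j - i) => //; rewrite -ei -ej mulrBr.
have [p [k' [p0 pd pk Ak]]] := image_path_slope Akl.
exists [set q | homotopic p q]; first by exists p.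
rewrite (class_cosetE p0 pk); apply/(coset_eq A0 AD AN).
have -> : (k', 0) - (b1, b2) = (k' - k, 0) - a.
  rewrite -ea /= in ek *; congr (_, _) => /=; first by rewrite ek; ring.
by apply: AD => //; apply: AN.
Qed.

End Counting.

Local Open Scope card_scope.

(* [X] is an arbitrary generating set of [H], used to construct [C(H)]. *)
Theorem proposition5p11 (R : realType) (H X : set (R -> R)) (dL dR : int)
  (H_sub : subgroupF H)
  (H_closed : closedF H)
  (H_minimal : minimal_action H)
  (A_rank : has_rank (pi_ab_image H) 2)
  (dL_pos : 0 < dL)
  (dL_gen : [set a.1 | a in pi_ab_image H] = multiples dL)
  (dR_pos : 0 < dR)
  (dR_gen : [set a.2 | a in pi_ab_image H] = multiples dR)
  (X_gen : generates X H)
  (u v : vertex (core X)) (u_inner : inner u) (v_inner : inner v) :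
  path_classes u v #=
    `I_(subgroup_index (multiples dL `*` multiples dR) (pi_ab_image H)).
Proof.
have [x [x01 xd xu]] := inner_at_point H_sub H_closed X_gen H_minimal u_inner.
have [y [y01 yd yv]] := inner_at_point H_sub H_closed X_gen H_minimal v_inner.
have bij := class_coset_bij H_sub H_closed H_minimal A_rank dL_gen dR_gen X_gen x01 y01 xd yd xu yv.
(* Finiteness ensures that [fset_set] returns the actual set of cosets and not its default value. *)
have [n hn] := (finite_setP _).1 (finite_cosets (image0 H_sub) (@imageD _ _ H_sub)
  (@imageN _ _ H_sub) (multiples dL `*` multiples dR) A_rank).
rewrite /subgroup_index (card_fset_set hn); apply: card_eq_trans hn.
by apply/card_set_bijP; eexists; exact: bij.
Qed.
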